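(* Let $k\in\mathbb Z$, $k\ge-1$. The vectors $$G^+(-1)^n\mathbf 1,\qquad G^-(-2)^n\mathbf 1$$ are singular in $\mathcal W^k$ for $n=k+2$.
   Context: For $k\in\mathbb C$, $k\ne -3$, $\mathcal W^k=\mathcal W^k(sl_3,f_\theta)$ is the universal Bershadsky-Polyakov vertex algebra of level $k$: the universal vertex algebra strongly generated by even fields $J,T,G^+,G^-$ with OPEs $J(z)J(w)\sim \frac{2k+3}{3}(z-w)^{-2}$, $G^\pm(z)G^\pm(w)\sim 0$, $J(z)G^\pm(w)\sim \pm G^\pm(w)(z-w)^{-1}$, $T(z)T(w)\sim \frac{c_k}{2}(z-w)^{-4}+2T(w)(z-w)^{-2}+DT(w)(z-w)^{-1}$, $T(z)G^\pm(w)\sim\frac32 G^\pm(w)(z-w)^{-2}+DG^\pm(w)(z-w)^{-1}$, $T(z)J(w)\sim J(w)(z-w)^{-2}+DJ(w)(z-w)^{-1}$, $G^+(z)G^-(w)\sim (k+1)(2k+3)(z-w)^{-3}+3(k+1)J(w)(z-w)^{-2}+\left(3:J(w)J(w):+\frac{3(k+1)}{2}DJ(w)-(k+3)T(w)\right)(z-w)^{-1}$, where $c_k=-\frac{(3k+1)(2k+3)}{k+3}$, $D$ is the derivative, and $\mathbf 1$ is the vacuum vector. Modes: $T(z)=\sum L_nz^{-n-2}$, $J(z)=\sum J_nz^{-n-1}$, $G^\pm(z)=\sum G^\pm_nz^{-n-1}$; $G^+(n)=G^+_n$, $G^-(n)=G^-_{n+1}$. A vector $v\in\mathcal W^k$ is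 singular if it is a nonzero eigenvector of $J_0$ and $L_0$ with $J_nv=L_nv=G^+_nv=G^-_nv=0$ for all $n\ge1$. *)

(* Defs.v *)
From HB Require Import structures.
From mathcomp Require Import all_boot all_order all_algebra.
From mathcomp Require Import reals complex.

Set Implicit Arguments.
Unset Strict Implicit.
Unset Printing Implicit Defensive.

Import Order.TTheory GRing.Theory Num.Theory.
Local Open Scope ring_scope.

(* The binomial coefficient m(m-1)...(m-j+1)/j! for an arbitrary integer m. *)
Definition binz (K : numFieldType) (m : int) (j : nat) : K :=
  (\prod_(i < j) (m%:~R - i%:R)) / (j`!)%:R.

(* Purely even vertex algebras, in terms of the n-th products
   a_(n) b = mode a n b, where Y(a, z) = \sum_(n : int) a_(n) z^(- n - 1).
   In the Borcherds identity the sums over all j >= 0 have finite support by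
   mode_trunc; they are truncated at an arbitrary M beyond which every term
   vanishes. *)
HB.mixin Record isVertexAlgebra (K : numFieldType) V of GRing.Lmodule K V := {
  vac : V;
  mode : V -> int -> V -> V;
  mode_linearl : forall (n : int) (b : V), linear (fun a => mode a n b);
  mode_linearr : forall (a : V) (n : int), linear (mode a n);
  mode_trunc : forall a b : V,
    exists N : nat, forall n : nat, (N <= n)%N -> mode a n%:Z b = 0;
  mode_vacl : forall (n : int) (a : V),
    mode vac n a = if n == - 1 then a else 0;
  mode_vacr : forall a : V, mode a (- 1) vac = a;
  mode_vacr_ge0 : forall (a : V) (n : nat), mode a n%:Z vac = 0;
  borcherds : forall (a b c : V) (m n l : int) (M : nat),
    (forall j : nat, (M <= j)%N ->
       [/\ mode a (n + j%:Z) b = 0,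
           mode b (l + j%:Z) c = 0 &
           mode a (m + j%:Z) c = 0]) ->
    \sum_(j < M) binz K m j *:
        mode (mode a (n + j%:Z) b) (m + l - j%:Z) c =
    \sum_(j < M) ((- 1) ^+ j * binz K n j) *:
        (mode a (m + n - j%:Z) (mode b (l + j%:Z) c)
         - (- 1) ^ n *: mode b (n + l - j%:Z) (mode a (m + j%:Z) c))
}.

#[short(type="vertexAlgType")]
HB.structure Definition VertexAlgebra (K : numFieldType) :=
  {V of isVertexAlgebra K V & GRing.Lmodule K V}.

Arguments vac {K s} : rename.

Section VertexAlgebraTheory.
Variable K : numFieldType.
Implicit Types V W : vertexAlgType K.

Definition deriv V (a : V) : V := mode a (- 2) vac.

(* The normally ordered product :a(z)b(z):, as a state. *)
Definition nop V (a b : V) : V := mode a (- 1) b.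

(* a(z)b(w) ~ \sum_j s_j (z-w)^(-j-1): the coefficient of the simple pole
   comes first in s. *)
Definition OPE V (a b : V) (s : seq V) : Prop :=
  forall j : nat, mode a j%:Z b = s`_j.

Definition va_morphism V W (f : {linear V -> W}) : Prop :=
  f vac = vac /\ forall (a b : V) (n : int), f (mode a n b) = mode (f a) n (f b).

(* The vector a^1_(-n_1-1) ... a^s_(-n_s-1) 1 for w = [:: (a^1, n_1); ...]. *)
Definition monomial V (w : seq (V * nat)) : V :=
  foldr (fun p v => mode p.1 (- (p.2.+1)%:Z) v) vac w.

Definition strongly_generated V (gens : seq V) : Prop :=
  forall v : V, exists r : seq (K * seq (V * nat)),
    all (fun t => all (fun p => p.1 \in gens) t.2) r /\
    v = \sum_(t <- r) t.1 *: monomial t.2.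

Record BPfields (V : Type) := BPFields { fJ : V; fT : V; fGp : V; fGm : V }.

Definition BP_central_charge (k : K) : K :=
  - ((3 * k + 1) * (2 * k + 3) / (k + 3)).

(* The central charge has k + 3 as a denominator: only meaningful for
   k != -3. *)
Definition BP_OPEs (k : K) V (x : BPfields V) : Prop :=
  let: BPFields J T Gp Gm := x in
  [/\ OPE J J [:: 0; ((2 * k + 3) / 3) *: vac],
      OPE Gp Gp [::] /\ OPE Gm Gm [::],
      OPE J Gp [:: Gp] /\ OPE J Gm [:: - Gm],
      OPE T T [:: deriv T; 2 *: T; 0; (BP_central_charge k / 2) *: vac] &
  [/\ OPE T Gp [:: deriv Gp; (3 / 2) *: Gp],
      OPE T Gm [:: deriv Gm; (3 / 2) *: Gm],
      OPE T J [:: deriv J; J] &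
      OPE Gp Gm
        [:: 3 *: nop J J + (3 * (k + 1) / 2) *: deriv J - (k + 3) *: T;
            (3 * (k + 1)) *: J;
            ((k + 1) * (2 * k + 3)) *: vac]]].

(* (V, x) is the universal Bershadsky-Polyakov vertex algebra of level k:
   it is strongly generated by x, and it is initial among the vertex algebras
   with four chosen elements subject to the same OPEs. This determines (V, x)
   up to a unique isomorphism. *)
Definition universal_BP (k : K) V (x : BPfields V) : Prop :=
  [/\ BP_OPEs k x,
      strongly_generated [:: fJ x; fT x; fGp x; fGm x] &
      forall (W : vertexAlgType K) (y : BPfields W), BP_OPEs k y ->
        let P (f : {linear V -> W}) :=
          va_morphism f /\
          [/\ f (fJ x) = fJ y, f (fT x) = fT y,
              f (fGp x) = fGp y & f (fGm x) = fGm y] in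
        exists f : {linear V -> W}, P f /\ forall g, P g -> g =1 f].

(* The field T has conformal weight indexing, T(z) = \sum_n L_n z^(-n-2),
   whereas J and G^+, G^- are indexed as Y(a, z) = \sum_n a_n z^(-n-1). *)
Definition Jm V (x : BPfields V) (n : int) : V -> V := mode (fJ x) n.
Definition Lm V (x : BPfields V) (n : int) : V -> V := mode (fT x) (n + 1).
Definition Gpm V (x : BPfields V) (n : int) : V -> V := mode (fGp x) n.
Definition Gmm V (x : BPfields V) (n : int) : V -> V := mode (fGm x) n.

(* The shifted modes G^+(n) = G^+_n and G^-(n) = G^-_{n+1}. *)
Definition Gplus V (x : BPfields V) (n : int) : V -> V := Gpm x n.
Definition Gminus V (x : BPfields V) (n : int) : V -> V := Gmm x (n + 1).

Definition singular V (x : BPfields V) (v : V) : Prop :=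
  [/\ v <> 0,
      exists q : K, Jm x 0 v = q *: v,
      exists h : K, Lm x 0 v = h *: v &
      forall n : int, 1 <= n ->
        [/\ Jm x n v = 0, Lm x n v = 0, Gpm x n v = 0 & Gmm x n v = 0]].

End VertexAlgebraTheory.

(* Main.v *)
(* For G^+ the annihilation conditions follow by induction on n: in
   G^-_1 (G^+_(-1))^(n+1) 1 and G^-_2 (G^+_(-1))^(n+1) 1 the factor n - k - 1
   comes out. The automorphism J -> - J, G^+ -> G^-, G^- -> - G^+ reduces the case
   of G^- to that of G^+.

   The vectors are nonzero because they are nonzero in a free field realisation:
   by universality W^k maps to the vertex algebra of two beta-gamma pairs (b, c)
   and (u, d) so that G^+ goes to b, whose creation modes are multiplications by
   variables of a polynomial ring. There
     J = - :bc: + u + (k+3)/3 Dd,   T = :bDc: + :uDd: + D(:bc:/2 + r u + s Dd),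
   and G^- is found by integrating the OPE of b with G^-. The OPEs of J, T and G^-
   with G^- need no explicit formula for G^-: the difference of the two sides is
   killed by all b_(m), m >= 0, and has negative charge, hence vanishes.

   The beta-gamma vertex algebra is built from its generating fields, by Dong's
   lemma and the uniqueness of the field attached to a state. *)

Require Import Defs.
From HB Require Import structures.
From mathcomp Require Import all_boot all_order all_algebra.
From mathcomp Require Import reals complex.
From mathcomp Require Import boolp classical_sets functions.
From mathcomp Require Import zify ring.

Set Implicit Arguments.
Unset Strict Implicit.
Unset Printing Implicit Defensive.

Import Order.TTheory GRing.Theory Num.Theory.
Local Open Scope ring_scope.

(** * Linear combinations and stable sums *)

(** Strong generation gives a spanning set of $\mathcal W^k$ but no linear independence, so it
    cannot show that a power of $G^+_{-1}$ is nonzero. A homomorphism out of $\mathcal W^k$ is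
    needed, and universality reduces its existence to a check of OPEs. If $G^+$ goes to a free field
    b, the image of the power is a monomial. Besides the pair (b, c), J and T require a Heisenberg
    algebra of rank two. It is found inside a second beta-gamma pair, generated by u and Dd, so that
    a single polynomial Fock space carries everything. The obstacle is $G^-$, a long cubic
    expression; its OPE with itself would be painful to expand. The modes $b_{(m)}$, m >= 0, are
    derivatives in the creation variables of c, and a vector killed by all of them contains no c, so
    its charge cannot be negative. This turns each OPE of $G^-$ into OPEs among the poles of $G^+$
    with $G^-$, in which only J and T occur. Powers of $G^-$ need no formula either: universality,
    applied to the fields of the realisation after the automorphism, gives a second homomorphism,
    with $G^-$ going to -b. *)

Section LinearCombinations.
Variables (K : numFieldType) (M : lmodType K).

Inductive lexp := LAtom of nat | LZero | LAdd of lexp & lexp | LOpp of lexp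
  | LScale of K & lexp.

Fixpoint leval (env : seq M) (e : lexp) : M :=
  match e with
  | LAtom n => nth 0 env n
  | LZero => 0
  | LAdd e1 e2 => leval env e1 + leval env e2
  | LOpp e1 => - leval env e1
  | LScale k e1 => k *: leval env e1
  end.

(** With [eqn] in place of [==], [cbv] reduces the coefficients of a reified term to explicit
    scalars. *)
Fixpoint lcoef (i : nat) (e : lexp) : K :=
  match e with
  | LAtom n => if eqn n i then 1 else 0
  | LZero => 0
  | LAdd e1 e2 => lcoef i e1 + lcoef i e2
  | LOpp e1 => - lcoef i e1
  | LScale k e1 => k * lcoef i e1
  end.

Fixpoint lcoef_eq (e1 e2 : lexp) (n : nat) : Prop :=
  if n is n'.+1 then lcoef n' e1 = lcoef n' e2 /\ lcoef_eq e1 e2 n' else True.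

Lemma levalE env e : leval env e = \sum_(i < size env) lcoef i e *: env`_i.
Proof.
elim: e => [n||e1 IH1 e2 IH2|e IH|k e IH] /=.
- have [lt|le] := ltnP n (size env); last first.
    rewrite nth_default // big1 // => i _; rewrite -[eqn n i]/(n == i :> nat).
    by rewrite gtn_eqF ?scale0r // (leq_trans _ le).
  rewrite (bigD1 (Ordinal lt)) //= -[eqn n n]/(n == n) eqxx scale1r.
  rewrite big1 ?addr0 // => i /negPf; rewrite -val_eqE /= eq_sym => ni.
  by rewrite -[eqn n i]/(n == i :> nat) ni scale0r.
- by rewrite big1 // => i _; rewrite scale0r.
- by rewrite IH1 IH2 -big_split; apply: eq_bigr => i _; rewrite scalerDl.
- by rewrite IH -sumrN; apply: eq_bigr => i _; rewrite scaleNr.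
- by rewrite IH scaler_sumr; apply: eq_bigr => i _; rewrite scalerA.
Qed.

Lemma leval_eq env e1 e2 : lcoef_eq e1 e2 (size env) -> leval env e1 = leval env e2.
Proof.
rewrite !levalE => eq12; apply: eq_bigr => -[i lt] _ /=.
elim: (size env) lt eq12 => //= n IHn; rewrite ltnS leq_eqVlt.
by case/predU1P => [-> [->] | lt [_ /(IHn lt)]].
Qed.

End LinearCombinations.

(* Atoms are compared up to conversion: the same operation may occur with
   different paths in the algebraic hierarchy. *)
Ltac lmod_insert x l :=
  match l with
  | nil => constr:(cons x nil)
  | cons ?y _ => let _ := match goal with _ => unify x y end in l
  | cons ?y ?t => let t' := lmod_insert x t in constr:(cons y t')
  end.

Ltac lmod_atoms t l :=
  lazymatch t with
  | (?a + ?b)%R => let l' := lmod_atoms a l in lmod_atoms b l'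
  | (- ?a)%R => lmod_atoms a l
  | (?k *: ?a)%R => lmod_atoms a l
  | 0%R => l
  | _ => lmod_insert t l
  end.

Ltac lmod_index x l :=
  match l with
  | cons ?y _ => let _ := match goal with _ => unify x y end in constr:(O)
  | cons _ ?t => let n := lmod_index x t in constr:(S n)
  end.

Ltac lmod_reify K l t :=
  lazymatch t with
  | (?a + ?b)%R =>
      let a' := lmod_reify K l a in let b' := lmod_reify K l b in constr:(LAdd a' b')
  | (- ?a)%R => let a' := lmod_reify K l a in constr:(LOpp a')
  | (?k *: ?a)%R => let a' := lmod_reify K l a in constr:(@LScale K k a')
  | 0%R => constr:(LZero K)
  | _ => let n := lmod_index t l in constr:(LAtom K n)
  end.

Ltac lmod_split K :=
  lazymatch goal with
  | |- @eq ?M ?x ?y =>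
      let l := lmod_atoms x (@nil M) in
      let l := lmod_atoms y l in
      let ex := lmod_reify K l x in
      let ey := lmod_reify K l y in
      refine (@leval_eq K _ l ex ey _); cbv [size lcoef_eq lcoef eqn]; do ?split
  end.

(* Proves an equality of linear combinations in an lmodType over K by comparing
   coefficients. *)
Ltac lmod :=
  match goal with
  | K : Num.NumField.type |- _ => lmod_split K; first [by [] | by ring | by field]
  end.


Section Binomials.
Variable K : numFieldType.
Implicit Types (m : int) (j : nat).

Lemma binz0 m : binz K m 0 = 1.
Proof. by rewrite /binz big_ord0 fact0 divr1. Qed.

Lemma binz_recr m j : binz K m j.+1 = binz K m j * (m%:~R - j%:R) / j.+1%:R.
Proof.
rewrite /binz big_ord_recr /= factS natrM; field.
by rewrite nat1r !pnatr_eq0 -!lt0n fact_gt0.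
Qed.

Lemma binzS m j : binz K (m + 1) j.+1 = binz K m j.+1 + binz K m j.
Proof.
have falls i : \prod_(t < i.+1) ((m + 1)%:~R - t%:R) =
    (m%:~R + 1) * \prod_(t < i) (m%:~R - t%:R) :> K.
  rewrite big_ord_recl subr0 intrD; congr (_ * _); apply: eq_bigr => t _.
  by rewrite /= /bump /= add1n -natr1; ring.
rewrite /binz falls big_ord_recr /= factS natrM; field.
by rewrite nat1r !pnatr_eq0 -!lt0n fact_gt0.
Qed.

Lemma binz1 m : binz K m 1 = m%:~R.
Proof. by rewrite binz_recr binz0 subr0 mul1r divr1. Qed.

Lemma binz_0l j : binz K 0 j = (j == 0%N)%:R.
Proof.
by case: j => [|j]; rewrite ?binz0 // /binz big_ord_recl subr0 !mul0r.
Qed.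

Lemma binz_N1l j : binz K (- 1) j = (- 1) ^+ j.
Proof.
elim: j => [|j IHj]; first by rewrite binz0.
have := binzS (- 1) j; rewrite addNr binz_0l IHj exprS => /esym/eqP.
by rewrite addr_eq0 => /eqP ->; rewrite mulN1r.
Qed.

(** The coefficient of z^(m-j) w^j in the expansion of (z - w)^m for |z| > |w|. *)
Definition sbinz m j : K := (- 1) ^+ j * binz K m j.

Lemma sbinz0 m : sbinz m 0 = 1.
Proof. by rewrite /sbinz binz0 mul1r. Qed.

Lemma sbinzS m j : sbinz (m + 1) j.+1 = sbinz m j.+1 - sbinz m j.
Proof. by rewrite /sbinz binzS exprS; ring. Qed.

Lemma sbinz_recr m j : sbinz m j.+1 * j.+1%:R = - (sbinz m j * (m%:~R - j%:R)).
Proof. by rewrite /sbinz binz_recr exprS; field; rewrite nat1r pnatr_eq0. Qed.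

End Binomials.

Section StableSums.
Variables (K : numFieldType) (M : lmodType K).
Implicit Types (f g : nat -> M) (n : int).

Definition evz f := exists N, forall j, (N <= j)%N -> f j = 0.

(** A sum over all naturals that carries no bound, so that identities between sums need not track
    one. By [ssumE] every valid bound gives the same value; without any bound the default 0 makes
    the sum empty. *)
Definition ssum f : M :=
  \sum_(j < xget 0%N [set N | forall j, (N <= j)%N -> f j = 0]%classic) f j.

Lemma ssumE f N : (forall j, (N <= j)%N -> f j = 0) -> ssum f = \sum_(j < N) f j.
Proof.
have widen N1 N2 : (forall j, (N1 <= j)%N -> f j = 0) -> (N1 <= N2)%N ->
    \sum_(j < N2) f j = \sum_(j < N1) f j.
  move=> f0 /subnKC <-; rewrite big_split_ord /= [X in _ + X]big1 ?addr0 //.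
  by move=> i _; rewrite f0 ?leq_addr.
move=> f0; rewrite /ssum; case: xgetP => [N' _ /= f0'|]; last by move/(_ N).
by case: (leqP N N') => [|/ltnW] le; [rewrite (widen N)|rewrite (widen N' N)].
Qed.

Lemma evz_lin k f g : evz f -> evz g -> evz (fun j => k *: f j + g j).
Proof.
move=> [N1 f0] [N2 g0]; exists (maxn N1 N2) => j.
by rewrite geq_max => /andP[le1 le2]; rewrite f0 ?g0 // scaler0 addr0.
Qed.

Lemma evzD f g : evz f -> evz g -> evz (fun j => f j + g j).
Proof.
by move=> ef eg; have [N z] := evz_lin 1 ef eg; exists N => j /z <-; rewrite scale1r.
Qed.

Lemma evzB f g : evz f -> evz g -> evz (fun j => f j - g j).
Proof.
move=> ef eg; have [N z] := evz_lin (- 1) eg ef; exists N => j /z <-.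
by rewrite scaleN1r addrC.
Qed.

Lemma evzZ (k : nat -> K) f : evz f -> evz (fun j => k j *: f j).
Proof. by move=> [N f0]; exists N => j le; rewrite f0 // scaler0. Qed.

Lemma evzS f : evz f -> evz (fun j => f j.+1).
Proof. by move=> [N f0]; exists N => j le; rewrite f0 // ltnW. Qed.

Lemma evz_map (phi : M -> M) f : phi 0 = 0 -> evz f -> evz (fun j => phi (f j)).
Proof. by move=> phi0 [N f0]; exists N => j le; rewrite f0. Qed.

Lemma ssum_lin k f g : evz f -> evz g ->
  ssum (fun j => k *: f j + g j) = k *: ssum f + ssum g.
Proof.
move=> [N1 f0] [N2 g0]; pose N := maxn N1 N2.
have {}f0 j : (N <= j)%N -> f j = 0 by rewrite geq_max => /andP[/f0].
have {}g0 j : (N <= j)%N -> g j = 0 by rewrite geq_max => /andP[_ /g0].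
rewrite (ssumE f0) (ssumE g0) (@ssumE _ N); last first.
  by move=> j le; rewrite f0 // g0 // scaler0 addr0.
by rewrite big_split scaler_sumr.
Qed.

Lemma ssumS f : evz f -> ssum f = f 0%N + ssum (fun j => f j.+1).
Proof.
move=> [N f0]; rewrite (@ssumE f N.+1) => [|j /ltnW/f0 //].
by rewrite (@ssumE _ N) ?big_ord_recl // => j le; rewrite f0 // ltnW.
Qed.

Lemma ssum0 f : (forall j, f j = 0) -> ssum f = 0.
Proof. by move=> f0; rewrite (@ssumE _ 0) ?big_ord0. Qed.

Lemma eq_ssum f g : f =1 g -> ssum f = ssum g.
Proof. by move=> /funext ->. Qed.

(** [asum] carries the weights of the right-hand side of the Borcherds identity and [csum] those of
    the left-hand side. Pascal's rule yields the recursions [asumS] and [csumS]. *)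
Definition asum n f := ssum (fun j => sbinz K n j *: f j).
Definition csum n f := ssum (fun j => binz K n j *: f j).

Lemma eq_asum n f g : f =1 g -> asum n f = asum n g.
Proof. by move=> /funext ->. Qed.

Lemma asum0 n f : (forall j, f j = 0) -> asum n f = 0.
Proof. by move=> f0; apply: ssum0 => j; rewrite f0 scaler0. Qed.

Lemma asum_lin k n f g : evz f -> evz g ->
  asum n (fun j => k *: f j + g j) = k *: asum n f + asum n g.
Proof.
move=> f0 g0; rewrite /asum -ssum_lin; try exact: evzZ.
by apply: eq_ssum => j; rewrite scalerDr !scalerA mulrC.
Qed.

Lemma asumD n f g : evz f -> evz g ->
  asum n (fun j => f j + g j) = asum n f + asum n g.
Proof.
move=> f0 g0; rewrite -[asum n f]scale1r -asum_lin //.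
by apply: eq_asum => j; rewrite scale1r.
Qed.

Lemma asumZ k n f : evz f -> asum n (fun j => k *: f j) = k *: asum n f.
Proof.
move=> f0; have := @asum_lin k n f (fun=> 0) f0; rewrite [asum n (fun=> 0)]asum0 // addr0.
by move=> <-; [apply: eq_asum => j; rewrite addr0 | exists 0%N].
Qed.

Lemma asumB n f g : evz f -> evz g ->
  asum n (fun j => f j - g j) = asum n f - asum n g.
Proof.
move=> f0 g0; rewrite addrC -scaleN1r -asum_lin //.
by apply: eq_asum => j; rewrite scaleN1r addrC.
Qed.

Lemma asum_map (phi : M -> M) n f : linear phi -> evz f ->
  phi (asum n f) = asum n (fun j => phi (f j)).
Proof.
move=> lin [N f0].
have phi0 : phi 0 = 0.
  by have := lin (- 1) 0 0; rewrite scaler0 addr0 scaleN1r addNr.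
have phiD x y : phi (x + y) = phi x + phi y.
  by have := lin 1 x y; rewrite !scale1r.
have phiZ k x : phi (k *: x) = k *: phi x.
  by have := lin k x 0; rewrite phi0 !addr0.
rewrite /asum (@ssumE _ N) => [|j le]; last by rewrite f0 ?scaler0.
rewrite (@ssumE _ N) => [|j le]; last by rewrite f0 ?phi0 ?scaler0.
by rewrite (big_morph phi phiD phi0); apply: eq_bigr => j _; rewrite phiZ.
Qed.

Lemma asumS n f : evz f ->
  asum (n + 1) f = asum n f - asum n (fun j => f j.+1).
Proof.
move=> f0; have f1 := evzS f0.
rewrite /asum ssumS ?[ssum (fun j => sbinz K n j *: f j)]ssumS; try exact: evzZ.
rewrite !sbinz0 -addrA; congr (_ + _).
rewrite addrC -scaleN1r -ssum_lin; try exact: evzZ.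
by apply: eq_ssum => j; rewrite sbinzS scalerBl scaleN1r addrC.
Qed.

Lemma csumS n f : evz f ->
  csum (n + 1) f = csum n f + csum n (fun j => f j.+1).
Proof.
move=> f0; have f1 := evzS f0.
rewrite /csum ssumS ?[ssum (fun j => binz K n j *: f j)]ssumS; try exact: evzZ.
rewrite !binz0 -addrA; congr (_ + _).
rewrite -[X in _ = X + _]scale1r -ssum_lin; try exact: evzZ.
by apply: eq_ssum => j; rewrite binzS scalerDl scale1r.
Qed.

Lemma csum0 f : csum 0 f = f 0%N.
Proof.
rewrite /csum (@ssumE _ 1) ?big_ord1 ?binz0 ?scale1r // => -[//|j] _.
by rewrite binz_0l scale0r.
Qed.

(** Term j of the first sum cancels term j + 1 of the second, by [sbinz_recr]. This is the summation
    by parts behind the translation covariance of n-th products. *)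
Lemma asum_telescope n f : evz f ->
  asum n (fun j => (n%:~R - j%:R) *: f j.+1) + asum n (fun j => j%:R *: f j) = 0.
Proof.
move=> f0; have f1 := evzS f0.
rewrite /asum [X in _ + X]ssumS; last by apply: evzZ; apply: evzZ.
rewrite scale0r scaler0 add0r -[X in X + _]scale1r -ssum_lin.
- by apply: ssum0 => j; rewrite scale1r !scalerA sbinz_recr -scalerDl subrr scale0r.
- by apply: evzZ; apply: evzZ.
- apply: (@evzZ (fun j => sbinz K n j.+1)).
  exact: (@evzZ (fun j => j.+1%:R)).
Qed.

End StableSums.

(** * Mutually local fields *)

Section Fields.
Variables (K : numFieldType) (M : lmodType K).
Implicit Types (a b c : int -> M -> M) (m n l s : int) (v : M).

Definition fld a := (forall n, linear (a n)) /\
  forall v, exists N : nat, forall j : nat, (N <= j)%N -> a j%:Z v = 0.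

Lemma fld0 a n : fld a -> a n 0 = 0.
Proof.
by move=> [lin _]; have := lin n (- 1) 0 0; rewrite scaler0 addr0 scaleN1r addNr.
Qed.

Lemma fldZ a n k v : fld a -> a n (k *: v) = k *: a n v.
Proof.
by move=> fa; have := fa.1 n k v 0; rewrite fld0 // !addr0.
Qed.

Lemma fldD a n u v : fld a -> a n (u + v) = a n u + a n v.
Proof. by move=> fa; have := fa.1 n 1 u v; rewrite !scale1r. Qed.

Lemma fldB a n u v : fld a -> a n (u - v) = a n u - a n v.
Proof. by move=> fa; rewrite -scaleN1r fldD ?fldZ // scaleN1r. Qed.

Lemma evz_dep (phi : nat -> M -> M) (f : nat -> M) :
  (forall j, phi j 0 = 0) -> evz f -> evz (fun j => phi j (f j)).
Proof. by move=> phi0 [N f0]; exists N => j le; rewrite f0. Qed.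

Lemma evz_fld a m v : fld a -> evz (fun j : nat => a (m + j%:Z) v).
Proof.
move=> [_ /(_ v)[N a0]]; exists (N + absz m)%N => j le.
have -> : m + j%:Z = (absz (m + j%:Z))%:Z by lia.
by apply: a0; lia.
Qed.

Lemma evz_fld2 a b (p : nat -> int) l v : fld a -> fld b ->
  evz (fun j : nat => a (p j) (b (l + j%:Z) v)).
Proof.
move=> fa fb; apply: (@evz_dep (fun j => a (p j))) => [j|]; first exact: fld0.
exact: evz_fld.
Qed.

(* The right-hand side of the Borcherds identity for fields on M; at m = 0 it is
   the definition of the n-th product of a and b. *)
Definition res a b m n l v : M :=
  asum n (fun j : nat => a (m + n - j%:Z) (b (l + j%:Z) v))
  - (- 1) ^ n *: asum n (fun j : nat => b (n + l - j%:Z) (a (m + j%:Z) v)).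

Lemma res_lin a b m n l : fld a -> fld b -> linear (res a b m n l).
Proof.
move=> fa fb k u v.
have lin2 x y (p : nat -> int) (i : int) : fld x -> fld y ->
    asum n (fun j : nat => x (p j) (y (i + j%:Z) (k *: u + v))) =
    k *: asum n (fun j : nat => x (p j) (y (i + j%:Z) u))
    + asum n (fun j : nat => x (p j) (y (i + j%:Z) v)).
  move=> fx fy; rewrite -asum_lin; try by apply evz_fld2.
  by apply: eq_asum => j; rewrite !(fldD, fldZ).
rewrite /res (lin2 a b (fun j => m + n - j%:Z)) //.
rewrite (lin2 b a (fun j => n + l - j%:Z)) //.
rewrite scalerBr !scalerDr !scalerA opprD addrACA.
by rewrite [_ * k]mulrC.
Qed.

(** One factor z - w is taken out of (z - w)^(n+1), in both expansion domains at once. This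
    recursion drives Dong's lemma and the Borcherds identity. *)
Lemma resS a b m n l v : fld a -> fld b ->
  res a b m (n + 1) l v = res a b (m + 1) n l v - res a b m n (l + 1) v.
Proof.
move=> fa fb; rewrite /res !asumS; try by apply evz_fld2.
rewrite expfzDr ?oppr_eq0 ?oner_eq0 // expr1z mulrN1 scaleNr opprK.
have -> : asum n (fun j : nat => a (m + (n + 1) - j.+1%:Z) (b (l + j.+1%:Z) v)) =
    asum n (fun j : nat => a (m + n - j%:Z) (b (l + 1 + j%:Z) v)).
  by apply: eq_asum => j; congr (a _ (b _ _)); lia.
have -> : asum n (fun j : nat => b (n + 1 + l - j.+1%:Z) (a (m + j.+1%:Z) v)) =
    asum n (fun j : nat => b (n + l - j%:Z) (a (m + 1 + j%:Z) v)).
  by apply: eq_asum => j; congr (b _ (a _ _)); lia.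
have -> : m + 1 + n = m + (n + 1) by lia.
have -> : n + (l + 1) = n + 1 + l by lia.
lmod.
Qed.

Definition diff2 (f : int -> int -> M) : int -> int -> M :=
  fun m l => f (m + 1) l - f m (l + 1).

Definition com a b v m l := a m (b l v) - b l (a m v).

(* Locality: (z - w)^N [a(z), b(w)] = 0; [diff2] is multiplication by z - w. *)
Definition local a b := exists N, forall v, iter N diff2 (com a b v) = fun _ _ => 0.

Lemma iter_diff2_lin N k f g :
  iter N diff2 (fun m l => k *: f m l + g m l) =
  fun m l => k *: iter N diff2 f m l + iter N diff2 g m l.
Proof.
elim: N f g => [|N IHN] f g //; rewrite !iterSr -IHN; congr (iter _ _ _).
by apply: funext => m; apply: funext => l; rewrite /diff2 scalerBr opprD addrACA.
Qed.

Lemma iter_diff2_0 N : iter N diff2 (fun _ _ => 0) = fun _ _ => 0.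
Proof.
by elim: N => //= N ->; apply: funext => m; apply: funext => l; rewrite /diff2 subr0.
Qed.

Lemma iter_diff2_map N (phi : M -> M) f : linear phi ->
  iter N diff2 (fun m l => phi (f m l)) = fun m l => phi (iter N diff2 f m l).
Proof.
move=> lin; elim: N f => [|N IHN] f //; rewrite !iterSr -IHN; congr (iter _ _ _).
apply: funext => m; apply: funext => l; rewrite /diff2.
by have := lin (- 1) (f m (l + 1)) (f (m + 1) l); rewrite !scaleN1r addrC => <-; rewrite addrC.
Qed.

Lemma iter_diff2_swap N f :
  iter N diff2 (fun m l => f l m) = fun m l => (- 1) ^+ N *: iter N diff2 f l m.
Proof.
elim: N f => [|N IHN] f.
  by apply: funext => m; apply: funext => l; rewrite scale1r.
rewrite iterS IHN; apply: funext => m; apply: funext => l.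
rewrite /diff2 /= -scalerBr exprS mulN1r scaleNr -scalerN opprB //.
Qed.

Lemma local_ge a b N N' : (N <= N')%N ->
  (forall v, iter N diff2 (com a b v) = fun _ _ => 0) ->
  (forall v, iter N' diff2 (com a b v) = fun _ _ => 0).
Proof. by move=> /subnK <- ab v; rewrite iterD ab iter_diff2_0. Qed.

Lemma local_sym a b : local a b -> local b a.
Proof.
move=> [N ab]; exists N => v.
have -> : com b a v = fun m l => (- 1) *: com a b v l m + 0.
  by apply: funext => m; apply: funext => l; rewrite addr0 scaleN1r opprB.
rewrite iter_diff2_lin iter_diff2_swap ab iter_diff2_0.
by apply: funext => m; apply: funext => l; rewrite !scaler0 addr0.
Qed.

Lemma local_lin k a b c : fld a -> local a b -> local a c ->
  local a (fun n v => k *: b n v + c n v).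
Proof.
move=> fa [N1 ab] [N2 ac]; exists (maxn N1 N2) => v.
have -> : com a (fun n v => k *: b n v + c n v) v =
    fun m l => k *: com a b v m l + com a c v m l.
  by apply: funext => m; apply: funext => l; rewrite /com fldD ?fldZ // scalerBr opprD addrACA.
rewrite iter_diff2_lin (local_ge _ ab) ?leq_maxl // (local_ge _ ac) ?leq_maxr //.
by apply: funext => m; apply: funext => l; rewrite scaler0 addr0.
Qed.

Lemma asum_0 (f : nat -> M) : asum 0 f = f 0%N.
Proof.
rewrite /asum (@ssumE _ _ _ 1) ?big_ord1 ?sbinz0 ?scale1r // => -[//|j] _.
by rewrite /sbinz binz_0l mulr0 scale0r.
Qed.

(** For n >= 0 both expansions of (z - w)^n are the same polynomial, so only the commutator is seen.
    Hence locality of order N makes [res] vanish for n >= N. *)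
Lemma res_nat a b (n : nat) v : fld a -> fld b ->
  (fun m l => res a b m n%:Z l v) = iter n diff2 (com a b v).
Proof.
move=> fa fb; elim: n => [|n IHn] /=.
  apply: funext => m; apply: funext => l.
  by rewrite /res !asum_0 expr0z scale1r !subr0 ?addr0 ?add0r.
rewrite -IHn; apply: funext => m; apply: funext => l.
by rewrite -addn1 PoszD resS.
Qed.

Definition nprod a b n : int -> M -> M := fun l v => res a b 0 n l v.

Lemma fld_nprod a b n : fld a -> fld b -> fld (nprod a b n).
Proof.
move=> fa fb; split=> [l|v]; first by apply res_lin.
have [Na a0] := fa.2 v; have [Nb b0] := fb.2 v.
(* Only the finitely many j < [Na] contribute to the second sum, so their truncation bounds have a
   common maximum. *)
have [Nc c0] : exists N : nat, forall j : nat, (j < Na)%N ->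
    forall i : nat, (N <= i)%N -> b (n + i%:Z - j%:Z) (a j%:Z v) = 0.
  elim: (Na) => [|N [Nc IHN]]; first by exists 0%N.
  have [N' b1] := evz_fld (n - N%:Z) (a N%:Z v) fb.
  exists (maxn Nc N') => j; rewrite ltnS leq_eqVlt => /orP[/eqP-> | lt] i.
    by rewrite geq_max => /andP[_ /b1]; rewrite addrAC.
  by rewrite geq_max => /andP[/IHN->].
exists (maxn Nb Nc) => l; rewrite geq_max => /andP[leb lec].
rewrite /nprod /res !asum0 ?scaler0 ?subr0 // => j.
  case: (ltnP j Na) => [lt|ge]; first by rewrite add0r c0.
  by rewrite add0r a0 ?fld0.
by rewrite -PoszD b0 ?fld0 // (leq_trans leb) ?leq_addr.
Qed.

(** * Dong's lemma *)

Section Dong.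
Implicit Types F G H : int -> int -> int -> M.

(* Multiplication by w - x, w - y, x - y in the variables dual to s, m, l. *)
Definition dwx F s m l := F (s + 1) m l - F s (m + 1) l.
Definition dwy F s m l := F (s + 1) m l - F s m (l + 1).
Definition dxy F s m l := F s (m + 1) l - F s m (l + 1).

Definition zero3 s m l : M := 0.
Definition lin3 (k : K) F G s m l := k *: F s m l + G s m l.

Lemma funext3 F G : (forall s m l, F s m l = G s m l) -> F = G.
Proof.
by move=> eq; apply: funext => s; apply: funext => m; apply: funext => l.
Qed.

Lemma lin3_0 k : lin3 k zero3 zero3 = zero3.
Proof. by apply: funext3 => s m l; rewrite /lin3 scaler0 addr0. Qed.

Lemma dwx_lin k F G : dwx (lin3 k F G) = lin3 k (dwx F) (dwx G).
Proof.
by apply: funext3 => s m l; rewrite /dwx /lin3 scalerBr opprD addrACA.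
Qed.

Lemma dwy_lin k F G : dwy (lin3 k F G) = lin3 k (dwy F) (dwy G).
Proof.
by apply: funext3 => s m l; rewrite /dwy /lin3 scalerBr opprD addrACA.
Qed.

Lemma iter_lin3 (d : (int -> int -> int -> M) -> (int -> int -> int -> M)) N k F G :
  (forall k F G, d (lin3 k F G) = lin3 k (d F) (d G)) ->
  iter N d (lin3 k F G) = lin3 k (iter N d F) (iter N d G).
Proof. by move=> dlin; elim: N => //= N ->. Qed.

Lemma iter_zero3 (d : (int -> int -> int -> M) -> (int -> int -> int -> M)) N :
  (forall k F G, d (lin3 k F G) = lin3 k (d F) (d G)) -> iter N d zero3 = zero3.
Proof.
move=> dlin; have := iter_lin3 N (- 1) zero3 zero3 dlin.
rewrite lin3_0 => ->; apply: funext3 => s m l.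
by rewrite /lin3 scaleN1r addNr.
Qed.

Lemma dwx_dwy F : dwx (dwy F) = dwy (dwx F).
Proof.
by apply: funext3 => s m l; rewrite /dwx /dwy; lmod.
Qed.

Lemma iter_dwx_dwy i e F : iter i dwx (iter e dwy F) = iter e dwy (iter i dwx F).
Proof.
have dwx_iter G : dwx (iter e dwy G) = iter e dwy (dwx G).
  by elim: e => //= e <-; rewrite dwx_dwy.
by elim: i => //= i ->.
Qed.

Lemma dwyE F : dwy F = lin3 1 (dwx F) (dxy F).
Proof.
by apply: funext3 => s m l; rewrite /lin3 scale1r /dwx /dxy addrA subrK.
Qed.

Lemma iter_dwx_dwyS i e F : iter i dwx (iter e.+1 dwy F) =
  lin3 1 (iter i.+1 dwx (iter e dwy F)) (iter i dwx (iter e dwy (dxy F))).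
Proof.
rewrite iterSr dwyE iter_lin3; last exact: dwy_lin.
rewrite iter_lin3; last exact: dwx_lin.
by rewrite !iter_dwx_dwy iterSr.
Qed.

Lemma iter_dwx_diff2 N F s m l :
  iter N dwx F s m l = iter N diff2 (fun s m => F s m l) s m.
Proof. by elim: N s m => //= N IHN s m; rewrite /dwx /diff2 !IHN. Qed.

Lemma iter_dwy_diff2 N F s m l :
  iter N dwy F s m l = iter N diff2 (fun s l => F s m l) s l.
Proof. by elim: N s l => //= N IHN s l; rewrite /dwy /diff2 !IHN. Qed.

Section Phi.
Variables (n : int) (p q : nat -> int).

(** Both halves of [res], commuted with a third field, have this form, with [p] and [q] exchanged.
    The shifts do not depend on (s, m, l), so multiplication by w - x and w - y passes through the
    sum. *)
Definition phi H s m l := asum n (fun j => H s (m + p j) (l + q j)).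
Definition summable H := forall s m l, evz (fun j => H s (m + p j) (l + q j)).

Lemma summable_dwx H : summable H -> summable (dwx H).
Proof.
move=> sH s m l.
have := evz_lin (- 1) (sH s (m + 1) l) (sH (s + 1) m l).
move=> [N z]; exists N => j le; rewrite -(z j le) /dwx addrC scaleN1r.
by congr (- H _ _ _ + _); ring.
Qed.

Lemma summable_dwy H : summable H -> summable (dwy H).
Proof.
move=> sH s m l.
have := evz_lin (- 1) (sH s m (l + 1)) (sH (s + 1) m l).
move=> [N z]; exists N => j le; rewrite -(z j le) /dwy addrC scaleN1r.
by congr (- H _ _ _ + _); ring.
Qed.

Lemma phi_dwx H : summable H -> dwx (phi H) = phi (dwx H).
Proof.
move=> sH; apply: funext3 => s m l; rewrite /dwx /phi -asumB //.
by apply: eq_asum => j; congr (_ - H _ _ _); ring.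
Qed.

Lemma phi_dwy H : summable H -> dwy (phi H) = phi (dwy H).
Proof.
move=> sH; apply: funext3 => s m l; rewrite /dwy /phi -asumB //.
by apply: eq_asum => j; congr (_ - H _ _ _); ring.
Qed.

Lemma iter_phi i e H : summable H ->
  iter i dwx (iter e dwy (phi H)) = phi (iter i dwx (iter e dwy H)).
Proof.
move=> sH.
have [-> sH'] : iter e dwy (phi H) = phi (iter e dwy H) /\ summable (iter e dwy H).
  elim: e => //= e [-> sH']; split; [exact: phi_dwy|exact: summable_dwy].
elim: i (iter e dwy H) sH' => // i IHi G sG.
rewrite !iterSr phi_dwx // IHi //; exact: summable_dwx.
Qed.

Lemma phi_zero3 : phi zero3 = zero3.
Proof. by apply: funext3 => s m l; rewrite /phi asum0. Qed.

End Phi.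

(** By the Leibniz rule [c, ab] = [c, a] b + a [c, b]: the first term is killed by (w - x)^r, the
    second by (w - y)^r. *)
Lemma kill_com a b c r v : fld a ->
  (forall v, iter r diff2 (com c a v) = fun _ _ => 0) ->
  (forall v, iter r diff2 (com c b v) = fun _ _ => 0) ->
  iter r dwx (iter r dwy (fun s m l => c s (a m (b l v)) - a m (b l (c s v)))) = zero3.
Proof.
move=> fa ca cb.
have -> : (fun s m l => c s (a m (b l v)) - a m (b l (c s v))) =
    lin3 1 (fun s m l => com c a (b l v) s m) (fun s m l => a m (com c b v s l)).
  by apply: funext3 => s m l; rewrite /lin3 scale1r /com fldB // addrA subrK.
rewrite !iter_lin3; try exact: dwx_lin; try exact: dwy_lin.
rewrite iter_dwx_dwy.
have -> : iter r dwx (fun s m l => com c a (b l v) s m) = zero3.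
  by apply: funext3 => s m l; rewrite iter_dwx_diff2 ca.
have -> : iter r dwy (fun s m l => a m (com c b v s l)) = zero3.
  apply: funext3 => s m l; rewrite iter_dwy_diff2.
  by rewrite (iter_diff2_map _ _ (fa.1 m)) cb fld0.
by rewrite !iter_zero3 ?lin3_0 //; [exact: dwx_lin|exact: dwy_lin].
Qed.

(* The F_n below vanish for n large, are killed by (w - x)^r (w - y)^r and satisfy
   (x - y) F_n = F_(n+1); expanding w - y = (w - x) + (x - y), a power of w - y
   kills each F_n. *)
Lemma dong a b c n : fld a -> fld b -> fld c ->
  local a b -> local c a -> local c b -> local c (nprod a b n).
Proof.
move=> fa fb fc [N ab] [N1 ca] [N2 cb]; pose r := maxn N1 N2.
have {}ca := local_ge (leq_maxl N1 N2 : (N1 <= r)%N) ca.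
have {}cb := local_ge (leq_maxr N1 N2 : (N2 <= r)%N) cb.
pose F v t : int -> int -> int -> M :=
  fun s m l => c s (res a b m t l v) - res a b m t l (c s v).
have FS v t : dxy (F v t) = F v (t + 1).
  apply: funext3 => s m l; rewrite /dxy /F !resS // (fldB s (res _ _ _ _ _ _) _ fc).
  lmod.
have F0 v (t : nat) : (N <= t)%N -> F v t%:Z = zero3.
  move=> le; have r0 u m l : res a b m t%:Z l u = 0.
    by have /(congr1 (fun f => f m l)) := res_nat t u fa fb; rewrite (local_ge le ab).
  by apply: funext3 => s m l; rewrite /F !r0 fld0 // subr0.
have Fr v t : iter r dwx (iter r dwy (F v t)) = zero3.
  pose H1 s m l := c s (a m (b l v)) - a m (b l (c s v)).
  pose H2 s m l := c s (b l (a m v)) - b l (a m (c s v)).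
  pose p (j : nat) : int := t - j%:Z; pose q (j : nat) : int := j%:Z.
  have s1 : summable p q H1.
    move=> s m l.
    have [N' z] := evz_lin (- 1) (evz_fld2 (fun j => m + p j) l (c s v) fa fb)
      (evz_map (fld0 s fc) (evz_fld2 (fun j => m + p j) l v fa fb)).
    by exists N' => j le; rewrite -(z j le) /H1 scaleN1r addrC.
  have s2 : summable q p H2.
    move=> s m l.
    have [N' z] := evz_lin (- 1) (evz_fld2 (fun j => l + p j) m (c s v) fb fa)
      (evz_map (fld0 s fc) (evz_fld2 (fun j => l + p j) m v fb fa)).
    by exists N' => j le; rewrite -(z j le) /H2 scaleN1r addrC.
  have -> : F v t = lin3 (- (- 1) ^ t) (phi t q p H2) (phi t p q H1).
    apply: funext3 => s m l; rewrite /lin3.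
    have -> : phi t p q H1 s m l =
        asum t (fun j : nat => c s (a (m + t - j%:Z) (b (l + j%:Z) v)))
        - asum t (fun j : nat => a (m + t - j%:Z) (b (l + j%:Z) (c s v))) :> M.
      rewrite -asumB; [|exact: (evz_map (fld0 s fc) (evz_fld2 _ _ _ fa fb))|by apply evz_fld2].
      by apply: eq_asum => j; rewrite /H1 /p /q addrA.
    have -> : phi t q p H2 s m l =
        asum t (fun j : nat => c s (b (t + l - j%:Z) (a (m + j%:Z) v)))
        - asum t (fun j : nat => b (t + l - j%:Z) (a (m + j%:Z) (c s v))) :> M.
      rewrite -asumB; [|exact: (evz_map (fld0 s fc) (evz_fld2 _ _ _ fb fa))|by apply evz_fld2].
      by apply: eq_asum => j; rewrite /H2 /p /q addrA (addrC l).
    rewrite /F /res fldB // fldZ // !(asum_map _ (fc.1 s)); try by apply evz_fld2.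
    lmod.
  rewrite !iter_lin3; try exact: dwx_lin; try exact: dwy_lin.
  rewrite !iter_phi // (kill_com v fa ca cb).
  have -> : iter r dwx (iter r dwy H2) = zero3.
    (* The opposite order of a and b follows from [kill_com] with the two fields exchanged, which
       interchanges w - x and w - y. *)
    apply: funext3 => s m l.
    have /(congr1 (fun G => G s l m)) := kill_com v fb cb ca.
    have iter_swap i e G s' x y :
        iter i dwx (iter e dwy (fun s m l => G s l m)) s' x y =
        iter i dwy (iter e dwx G) s' y x.
      elim: i s' x y => [|i IHi] s' x y /=; last by rewrite /dwx /dwy !IHi.
      by elim: e s' x y => //= e IHe s' x y; rewrite /dwx /dwy !IHe.
    by rewrite (iter_swap r r H2) -iter_dwx_dwy.
  by rewrite !phi_zero3 lin3_0.
(* The outer induction descends from N, where F vanishes, to N - d. The inner one trades factors w -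
   x for factors w - y, starting from [Fr]; at i = r no factor w - x is left. *)
have {Fr}kill d i v : (i <= r)%N ->
    iter (r - i) dwx (iter (r + d + i) dwy (F v (N%:Z - d%:Z))) = zero3.
  elim: d i => [|d IHd] i le.
    by rewrite subr0 F0 // !iter_zero3 //; [exact: dwx_lin|exact: dwy_lin].
  elim: i le => [|i IHi] le.
    rewrite subn0 addn0 addnC iterD iter_dwx_dwy Fr iter_zero3 //.
    exact: dwy_lin.
  rewrite addnS iter_dwx_dwyS FS subnSK // IHi 1?ltnW //.
  have -> : N%:Z - d.+1%:Z + 1 = N%:Z - d%:Z by lia.
  by rewrite addnS addSnnS IHd // lin3_0.
have [e Fe] : exists e, forall v, iter e dwy (F v n) = zero3.
  have [le|lt] := lerP N%:Z n.
    by exists 0%N => v /=; have := F0 v (absz n); rewrite gez0_abs; [apply; lia|lia].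
  exists (r + absz (N%:Z - n)%R + r)%N => v.
  have := kill (absz (N%:Z - n)) r v (leqnn r); rewrite subnn /=.
  by have -> : N%:Z - (absz (N%:Z - n))%:Z = n by lia.
exists e => v; apply: funext => s; apply: funext => l.
by rewrite -[LHS](iter_dwy_diff2 e (F v n) s 0 l) Fe.
Qed.

End Dong.
End Fields.

(** * Reconstruction of a vertex algebra from generating fields *)

Section Reconstruction.
Variables (K : numFieldType) (M : lmodType K).
Variables (v0 : M) (T : M -> M) (I : Type) (g : I -> int -> M -> M).
Implicit Types (a b c : int -> M -> M) (n l : int) (v : M).

Definition covariant a :=
  forall n v, T (a n v) = a n (T v) - n%:~R *: a (n - 1) v.

Definition admissible a :=
  [/\ fld a, forall n : nat, a n%:Z v0 = 0 & covariant a].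

Definition idfield n v : M := if n == - 1 then v else 0.

Hypotheses (T_lin : linear T) (T_vac : T v0 = 0).

Lemma admissible_lin k a b : admissible a -> admissible b ->
  admissible (fun n v => k *: a n v + b n v).
Proof.
move=> [fa va ca] [fb vb cb]; split=> [|n|n v]; last 2 first.
- by rewrite va vb scaler0 addr0.
- by rewrite T_lin ca cb; lmod.
split=> [n k' u v|v]; first by rewrite !(fldD, fldZ) //; lmod.
have [N1 a0] := fa.2 v; have [N2 b0] := fb.2 v; exists (maxn N1 N2) => j.
by rewrite geq_max => /andP[le1 le2]; rewrite a0 // b0 // scaler0 addr0.
Qed.

Lemma admissible_id : admissible idfield.
Proof.
have T0 : T 0 = 0.
  by have := T_lin (- 1) 0 0; rewrite scaler0 addr0 scaleN1r addNr.
split=> [|//|n v]; last first.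
  rewrite /idfield; case: (eqVneq n (- 1)) => [->|n1]; first by rewrite scaler0 subr0.
  case: eqVneq => [n0|_]; last by rewrite T0 scaler0 subr0.
  by rewrite (_ : n = 0) ?scale0r ?subr0 //; lia.
split=> [n k u v|v]; last by exists 0%N.
by rewrite /idfield; case: eqP => _ //; rewrite scaler0 addr0.
Qed.

Lemma admissible_nprod a b n : admissible a -> admissible b ->
  admissible (nprod a b n).
Proof.
move=> [fa va ca] [fb vb cb]; split; first exact: fld_nprod.
- move=> l; rewrite /nprod /res !asum0 ?scaler0 ?subr0 // => j.
    by rewrite add0r va fld0.
  by rewrite -PoszD vb fld0.
move=> l v; rewrite /nprod /res.
have TB x y : T (x - y) = T x - T y.
  by have := T_lin (- 1) y x; rewrite !scaleN1r [_ + x]addrC [_ + T x]addrC.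
have T0 : T 0 = 0 by have := TB 0 0; rewrite !subrr.
have TZ k x : T (k *: x) = k *: T x.
  by have := T_lin k x 0; rewrite T0 !addr0.
pose f1 (j : nat) := a (0 + n - j%:Z) (b (l - 1 + j%:Z) v).
pose f2 (j : nat) := b (n + l - j%:Z) (a (- 1 + j%:Z) v).
have e1 : evz f1 by apply evz_fld2.
have e2 : evz f2 by apply evz_fld2.
have s1 := evzS e1; have s2 := evzS e2.
have z1 (k : nat -> K) := evzZ k e1; have z1' (k : nat -> K) := evzZ k s1.
have z2 (k : nat -> K) := evzZ k e2; have z2' (k : nat -> K) := evzZ k s2.
rewrite TB TZ !(asum_map _ T_lin); try by apply evz_fld2.
(* Covariance of both factors produces -(l + j) [f1] j - (n - j) [f1] (j + 1); by [asum_telescope]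
   all but -l [f1] j sums to zero. The second sum is treated in the same way. *)
have -> : asum n (fun j : nat => T (a (0 + n - j%:Z) (b (l + j%:Z) v))) =
    asum n (fun j : nat => a (0 + n - j%:Z) (b (l + j%:Z) (T v)))
    - l%:~R *: asum n f1.
  have ev := evz_fld2 (fun j => 0 + n - j%:Z) l (T v) fa fb.
  rewrite -[RHS]subr0 -(asum_telescope n e1) -asumZ // -asumD // -!asumB //.
    apply: eq_asum => j; rewrite ca cb fldB // fldZ // /f1.
    have -> : l - 1 + j.+1%:Z = l + j%:Z by lia.
    have -> : 0 + n - j.+1%:Z = 0 + n - j%:Z - 1 by lia.
    have -> : l - 1 + j%:Z = l + j%:Z - 1 by lia.
    by rewrite !intrD; lmod.
  - exact: evzB.
  - exact: evzD.
have -> : asum n (fun j : nat => T (b (n + l - j%:Z) (a (0 + j%:Z) v))) =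
    asum n (fun j : nat => b (n + l - j%:Z) (a (0 + j%:Z) (T v)))
    - l%:~R *: asum n (fun j => f2 j.+1).
  have ev := evz_fld2 (fun j => n + l - j%:Z) 0 (T v) fb fa.
  rewrite -[RHS]subr0 -(asum_telescope n e2) -asumZ // -asumD // -!asumB //.
    apply: eq_asum => j; rewrite cb ca fldB // fldZ // /f2.
    have -> : - 1 + j.+1%:Z = 0 + j%:Z by lia.
    have -> : n + l - j.+1%:Z = n + l - j%:Z - 1 by lia.
    have -> : - 1 + j%:Z = 0 + j%:Z - 1 by lia.
    by rewrite !(add0r, intrD); lmod.
  - exact: evzB.
  - exact: evzD.
have -> : asum n (fun j : nat => b (n + (l - 1) - j%:Z) (a (0 + j%:Z) v)) =
    asum n (fun j => f2 j.+1).
  by apply: eq_asum => j; rewrite /f2; congr (b _ (a _ _)); lia.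
by rewrite /f1; lmod.
Qed.

Lemma local_id a : fld a -> local a idfield.
Proof.
move=> fa; exists 0%N => v; apply: funext => m; apply: funext => l.
by rewrite /= /com /idfield; case: eqP => _; rewrite ?fld0 ?subrr.
Qed.

Hypotheses (g_fld : forall i, fld (g i)) (g_local : forall i j, local (g i) (g j)).
Hypothesis g_vac : forall i (n : nat), g i n%:Z v0 = 0.
Hypothesis g_cov : forall i, covariant (g i).
Hypothesis g_span : forall P : M -> Prop, P v0 ->
  (forall k u v, P u -> P v -> P (k *: u + v)) ->
  (forall i n v, P v -> P (g i n v)) -> forall v, P v.

Lemma admissible_g i : admissible (g i). Proof. by split. Qed.

(* Only generators occur as left factors, so that mutual locality can be proved
   by two successive inductions. *)
Inductive genfield : (int -> M -> M) -> Prop :=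
| Genfield_id : genfield idfield
| Genfield_lin k a b : genfield a -> genfield b ->
    genfield (fun n v => k *: a n v + b n v)
| Genfield_nprod i a n : genfield a -> genfield (nprod (g i) a n).

Lemma genfield_admissible a : genfield a -> admissible a.
Proof.
elim=> [|k b c _ ab _ ac|i b n _ ab].
- exact: admissible_id.
- exact: admissible_lin.
- by apply: admissible_nprod => //; exact: admissible_g.
Qed.

Lemma genfield_fld a : genfield a -> fld a.
Proof. by case/genfield_admissible. Qed.

Lemma genfield_local_g i a : genfield a -> local (g i) a.
Proof.
move=> ua; elim: ua i => [|k b c _ ab _ ac|j b n ub ab] i.
- exact: local_id.
- exact: local_lin.
- by apply: dong => //; exact: genfield_fld.
Qed.

Lemma genfield_local a b : genfield a -> genfield b -> local a b.
Proof.
move=> ua ub; have fb := genfield_fld ub; apply: local_sym.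
elim: ua => [|k c d _ ac _ ad|i c n uc ac].
- exact: local_id.
- exact: local_lin.
- apply: dong => //; first exact: genfield_fld.
    exact: genfield_local_g.
  by apply: local_sym; exact: genfield_local_g.
Qed.

Lemma nprod_vac a b n : admissible a -> admissible b ->
  nprod a b n (- 1) v0 = a n (b (- 1) v0).
Proof.
move=> [fa va _] [fb vb _]; rewrite /nprod /res.
rewrite [X in _ - _ *: X]asum0 => [|j]; last by rewrite add0r va fld0.
rewrite scaler0 subr0 /asum (@ssumE _ _ _ 1) => [|[//|j] _]; last first.
  by rewrite (_ : - 1 + j.+1%:Z = j%:Z) ?vb ?fld0 ?scaler0 //; lia.
by rewrite big_ord1 sbinz0 scale1r add0r subr0 addr0.
Qed.

Lemma genfield_state v : exists a, genfield a /\ a (- 1) v0 = v.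
Proof.
elim/g_span: v => [|k u v [a [ua <-]] [b [ub <-]]|i n v [a [ua <-]]].
- by exists idfield; split=> //; exact: Genfield_id.
- by exists (fun n v => k *: a n v + b n v); split=> //; exact: Genfield_lin.
- exists (nprod (g i) a n); split; first exact: Genfield_nprod.
  by rewrite nprod_vac //; exact: genfield_admissible.
Qed.

(** Goddard's uniqueness argument for d = a - b. Since T kills [v0], covariance propagates d_(-1)
    [v0] = 0 to all lower modes, so d(z) [v0] = 0. Locality then gives (z - w)^N d(z) c(w) [v0] = 0,
    and w = 0 leaves z^N d(z) applied to the state of c; such states exhaust M. *)
Lemma field_unique a b : admissible a -> admissible b ->
  (forall c, genfield c -> local a c /\ local b c) ->
  a (- 1) v0 = b (- 1) v0 -> a = b.
Proof.
move=> aa ab loc eqab; pose d n v := (- 1) *: b n v + a n v.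
have [fd vd cd] : admissible d by exact: admissible_lin.
have d0 (n : nat) : d (- n.+1%:Z) v0 = 0.
  elim: n => [|n IHn]; first by rewrite /d eqab scaleN1r addNr.
  have := cd (- n.+1%:Z) v0; rewrite IHn T_vac fld0 // sub0r.
  have -> : T 0 = 0.
    by have := T_lin (- 1) 0 0; rewrite scaler0 addr0 scaleN1r addNr.
  have -> : - n.+1%:Z - 1 = - n.+2%:Z by lia.
  move=> /esym/eqP; rewrite oppr_eq0 scaler_eq0 intr_eq0 => /orP[|/eqP //].
  by rewrite oppr_eq0.
have dv0 n : d n v0 = 0.
  case: n => n; first exact: vd.
  by rewrite NegzE d0.
suff dv n v : d n v = 0.
  apply: funext => n; apply: funext => v; have := dv n v.
  by rewrite /d scaleN1r addrC => /eqP; rewrite subr_eq0 => /eqP.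
have [c [uc <-]] := genfield_state v.
have [fc vc _] := genfield_admissible uc.
have [N dc] : local d c.
  apply: local_sym; apply: local_lin => //.
    by apply: local_sym; have [] := loc _ uc.
  by apply: local_sym; have [] := loc _ uc.
have {dc} := congr1 (fun f => f (n - N%:Z) (- 1)) (dc v0).
(* Index -1 is the constant term in w and the nonnegative indices vanish, so each factor z - w acts
   there as z. *)
have shift (F : int -> int -> M) : (forall m (l : nat), F m l%:Z = 0) ->
    forall m, iter N (@diff2 K M) F m (- 1) = F (m + N%:Z) (- 1).
  elim: N F => [|N' IHN] F F0 m; first by rewrite addr0.
  rewrite iterSr IHN => [|m' l]; last by rewrite /diff2 F0 -PoszD F0 subr0.
  by rewrite /diff2 (_ : - 1 + 1 = 0) // F0 subr0; congr F; lia.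
rewrite shift => [|m l]; rewrite /com dv0 fld0 // subr0 ?subrK //.
by rewrite vc fld0.
Qed.

(** The choice is harmless: [state_field_unique] identifies it with any admissible field that has
    the same state and is local to all generated fields. *)
Definition state_field v := sval (cid (genfield_state v)).

Lemma state_fieldP v : genfield (state_field v) /\ state_field v (- 1) v0 = v.
Proof. exact: (svalP (cid (genfield_state v))). Qed.

Lemma state_field_unique a v : admissible a ->
  (forall c, genfield c -> local a c) -> a (- 1) v0 = v -> state_field v = a.
Proof.
move=> aa la av; have [uv vv] := state_fieldP v.
apply: field_unique => //; first exact: genfield_admissible.
  by move=> c uc; split; [exact: genfield_local|exact: la].
by rewrite vv.
Qed.

Lemma state_field_lin k u v :
  state_field (k *: u + v) = fun n w => k *: state_field u n w + state_field v n w.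
Proof.
have [uu eu] := state_fieldP u; have [uv ev] := state_fieldP v.
apply: state_field_unique.
- by apply: admissible_lin; exact: genfield_admissible.
- by move=> c uc; apply: genfield_local => //; exact: Genfield_lin.
- by rewrite eu ev.
Qed.

Lemma state_field_nprod u n v :
  state_field (state_field u n v) = nprod (state_field u) (state_field v) n.
Proof.
have [uu eu] := state_fieldP u; have [uv ev] := state_fieldP v.
have au := genfield_admissible uu; have av := genfield_admissible uv.
apply: state_field_unique.
- exact: admissible_nprod.
- move=> c uc; apply: local_sym; apply: dong;
    by [exact: genfield_fld | exact: genfield_local].
- by rewrite nprod_vac // ev.
Qed.

Lemma state_field_vac : state_field v0 = idfield.
Proof.
apply: state_field_unique => //; first exact: admissible_id.
by move=> c uc; apply: local_sym; apply: local_id; exact: genfield_fld.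
Qed.

Lemma state_field_g i : state_field (g i (- 1) v0) = g i.
Proof.
by apply: state_field_unique => // c; exact: genfield_local_g.
Qed.

Lemma state_field_fld v : fld (state_field v).
Proof. by apply: genfield_fld; case: (state_fieldP v). Qed.

(* Both sides of the identity at (m, n, l) satisfy F(m+1,n,l) - F(m,n,l+1) =
   F(m,n+1,l), both vanish for n large, and they agree at m = 0. *)
Lemma state_field_borcherds u v w m n l :
  csum m (fun j : nat => state_field (state_field u (n + j%:Z) v) (m + l - j%:Z) w)
  = res (state_field u) (state_field v) m n l w.
Proof.
pose L m n l := csum m (fun j : nat =>
  state_field (state_field u (n + j%:Z) v) (m + l - j%:Z) w).
pose R m n l := res (state_field u) (state_field v) m n l w.
have fu := state_field_fld u; have fv := state_field_fld v.
have sf0 : state_field 0 = fun _ _ => 0.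
  have := state_field_lin (- 1) 0 0; rewrite scaler0 addr0 => ->.
  by apply: funext => i; apply: funext => x; rewrite scaleN1r addNr.
have Lev i (p : nat -> int) : evz (fun j : nat =>
    state_field (state_field u (i + j%:Z) v) (p j) w).
  have [N u0] := evz_fld i v fu.
  by exists N => j le; rewrite u0 // sf0.
have LS i j t : L (i + 1) j t = L i j (t + 1) + L i (j + 1) t.
  rewrite /L csumS //; congr (csum _ _ + csum _ _); apply: funext => s.
    by congr (state_field _ _ _); lia.
  by congr (state_field (state_field _ _ _) _ _); lia.
have RS i j t : R (i + 1) j t = R i j (t + 1) + R i (j + 1) t.
  by rewrite /R [res _ _ _ (j + 1) _ _]resS //; lmod.
have L0 j t : L 0 j t = R 0 j t.
  by rewrite /L csum0 addr0 state_field_nprod add0r subr0.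
rewrite -/(L m n l) -/(R m n l).
have [uu _] := state_fieldP u; have [uv _] := state_fieldP v.
have [N1 loc] := genfield_local uu uv; have [N2 u0] := fu.2 v.
pose N := maxn N1 N2.
have big i (j : nat) t : (N <= j)%N -> L i j%:Z t = R i j%:Z t.
  rewrite geq_max => /andP[le1 le2]; rewrite /L /R /csum ssum0 => [|s]; last first.
    by rewrite -PoszD u0 ?sf0 ?scaler0 // (leq_trans le2) ?leq_addr.
  have /(congr1 (fun f => f i t)) := res_nat j w fu fv.
  by rewrite (local_ge le1 loc).
case: m => m.
  elim: m n l => [|m IHm] n l; first exact: L0.
  by rewrite -addn1 PoszD LS RS !IHm.
rewrite NegzE; elim: m.+1 n l => [|{}m IHm] n l; first by rewrite oppr0 L0.
(* For negative m the recursion in m is read backwards. This costs a second induction, descending in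
   n from the range where both sides vanish. *)
have down (d : nat) t : L (- m.+1%:Z) (N%:Z - d%:Z) t = R (- m.+1%:Z) (N%:Z - d%:Z) t.
  elim: d t => [|d IHd] t; first by rewrite subr0 big.
  have := LS (- m.+1%:Z) (N%:Z - d.+1%:Z) (t - 1).
  have := RS (- m.+1%:Z) (N%:Z - d.+1%:Z) (t - 1).
  have -> : - m.+1%:Z + 1 = - m%:Z by lia.
  have -> : N%:Z - d.+1%:Z + 1 = N%:Z - d%:Z by lia.
  have -> : t - 1 + 1 = t by lia.
  by rewrite IHm IHd => -> /addIr.
have [le|lt] := lerP N%:Z n.
  by have := big (- m.+1%:Z) (absz n) l; rewrite gez0_abs; [apply; lia|lia].
have := down (absz (N%:Z - n)) l.
by have -> : N%:Z - (absz (N%:Z - n))%:Z = n by lia.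
Qed.

End Reconstruction.

(** * The rank two beta-gamma vertex algebra *)

Section Fock.
Variable K : numFieldType.

(* Multi-indices of monomials in the variables X_(e, s, n), which stand for the
   creation modes beta^e_(-n-1) (s = true) and gamma^e_(-n-1) (s = false). *)
Definition bgvar : eqType := ((bool * bool) * nat)%type.
Definition multiindex := bgvar -> nat.

Definition incr (i : bgvar) (e : multiindex) : multiindex := fun j => (e j + (j == i))%N.
Definition decr (i : bgvar) (e : multiindex) : multiindex := fun j => (e j - (j == i))%N.

(** On arbitrary functions of multi-indices, multiplication and derivation are pointwise formulas;
    the polynomials are cut out afterwards as the span of the monomials. *)
Definition series := multiindex -> K^o.

(* Monomials are normalised as divided powers; the junk value of [decr] at
   e i = 0 is multiplied by 0. *)
Definition mulX (i : bgvar) (f : series) : series := fun e => (e i)%:R * f (decr i e).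
Definition derX (i : bgvar) (f : series) : series := fun e => f (incr i e).
Definition series1 : series := fun e => (`[< forall i, e i = 0%N >])%:R.

Inductive polynomial_series : series -> Prop :=
| Polynomial_1 : polynomial_series series1
| Polynomial_lin k f h : polynomial_series f -> polynomial_series h ->
    polynomial_series (k *: f + h)
| Polynomial_mulX i f : polynomial_series f -> polynomial_series (mulX i f).

Lemma mulX_lin i : linear (mulX i).
Proof.
by move=> k f h; apply: funext => e; rewrite /mulX /= mulrDr !fctE /= mulrCA.
Qed.

Lemma derX_lin i : linear (derX i).
Proof. by []. Qed.

Lemma decr_incr i e : decr i (incr i e) = e.
Proof. by apply: funext => j; rewrite /decr /incr addnK. Qed.

Lemma derX_mulX i j f : derX i (mulX j f) = mulX j (derX i f) + (i == j)%:R *: f.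
Proof.
apply: funext => e.
change ((e j + (j == i))%:R * f (decr j (incr i e)) =
  (e j)%:R * f (incr i (decr j e)) + (i == j)%:R * f e).
have [<-|ij] := eqVneq i j.
  rewrite decr_incr mul1r natrD mulrDl mul1r; congr (_ + _).
  case ei: (e i) => [|n]; first by rewrite !mul0r.
  congr (_ * f _); apply: funext => l; rewrite /incr /decr; case: eqP => [->|_].
    by rewrite ei subnK.
  by rewrite subn0 addn0.
rewrite mul0r addr0 addn0; congr (_ * f _).
apply: funext => l; rewrite /incr /decr.
case: (eqVneq l i) => [->|_]; last by rewrite !addn0.
by rewrite (negPf ij) !subn0.
Qed.

Lemma derX_comm i j f : derX i (derX j f) = derX j (derX i f).
Proof.
by apply: funext => e; congr f; apply: funext => l; rewrite /incr addnAC.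
Qed.

Lemma mulX_comm i j f : mulX i (mulX j f) = mulX j (mulX i f).
Proof.
apply: funext => e; have [->//|ij] := eqVneq i j.
have d l k : l != k -> decr k e l = e l by rewrite /decr => /negPf ->; rewrite subn0.
rewrite /mulX d 1?eq_sym // d // mulrCA.
by congr (_ * (_ * f _)); apply: funext => l; rewrite /decr subnAC.
Qed.

Lemma derX_1 i : derX i series1 = 0.
Proof.
apply: funext => e; rewrite /derX /series1; case: asboolP => // /(_ i).
by rewrite /incr eqxx addn1.
Qed.

Lemma polynomial_derX i f : polynomial_series f -> polynomial_series (derX i f).
Proof.
elim=> [|k u v _ IHu _ IHv|j u pu IHu].
- have -> : derX i series1 = (- 1) *: series1 + series1.
    by rewrite derX_1 scaleN1r addNr.
  by apply: Polynomial_lin; exact: Polynomial_1.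
- by rewrite derX_lin; exact: Polynomial_lin.
- by rewrite derX_mulX addrC; apply: Polynomial_lin => //; exact: Polynomial_mulX.
Qed.

Definition polynomial_pred : {pred series} := fun f => `[< polynomial_series f >].

Lemma polynomial_submod : submod_closed polynomial_pred.
Proof.
split=> [|k u v /asboolP pu /asboolP pv]; apply/asboolP.
  rewrite -(addNr series1) -scaleN1r.
  by apply: Polynomial_lin; exact: Polynomial_1.
exact: Polynomial_lin.
Qed.
HB.instance Definition _ := GRing.isSubmodClosed.Build K series polynomial_pred
  polynomial_submod.

Record fock := Fock { fock_val : series; _ : fock_val \in polynomial_pred }.
HB.instance Definition _ := [isSub for fock_val].
HB.instance Definition _ := [Choice of fock by <:].
HB.instance Definition _ := [SubChoice_isSubLmodule of fock by <:].

Lemma fock_valP k (u v : fock) : fock_val (k *: u + v) = k *: fock_val u + fock_val v.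
Proof. by []. Qed.

Lemma fock_polynomial (v : fock) : polynomial_series (val v).
Proof. by apply/asboolP; exact: (valP v). Qed.

Definition fock_of f (pf : polynomial_series f) : fock := Fock (introT (asboolP _) pf).

Definition fock1 : fock := fock_of Polynomial_1.
Definition fockX i (v : fock) : fock := fock_of (Polynomial_mulX i (fock_polynomial v)).
Definition fockD i (v : fock) : fock := fock_of (polynomial_derX i (fock_polynomial v)).

Lemma fock_ind (P : fock -> Prop) : P fock1 ->
  (forall k u v, P u -> P v -> P (k *: u + v)) ->
  (forall i v, P v -> P (fockX i v)) -> forall v, P v.
Proof.
move=> P1 Plin PX v.
suff: forall f, polynomial_series f -> forall v, val v = f -> P v.
  by move/(_ _ (fock_polynomial v)); apply.
move=> f; elim=> [|k u w pu IHu pw IHw|i u pu IHu] {}v ev.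
- by have -> : v = fock1 by exact: val_inj.
- have -> : v = k *: fock_of pu + fock_of pw by exact: val_inj.
  by apply: Plin; [exact: IHu|exact: IHw].
- have -> : v = fockX i (fock_of pu) by exact: val_inj.
  by apply: PX; exact: IHu.
Qed.

Lemma fockX_lin i : linear (fockX i).
Proof.
move=> k u v; apply: val_inj.
change (mulX i (fock_val (k *: u + v)) = fock_val (k *: fockX i u + fockX i v)).
by rewrite !fock_valP mulX_lin.
Qed.

Lemma fockD_lin i : linear (fockD i).
Proof.
move=> k u v; apply: val_inj.
change (derX i (fock_val (k *: u + v)) = fock_val (k *: fockD i u + fockD i v)).
by rewrite !fock_valP.
Qed.

HB.instance Definition _ i := GRing.isLinear.Build K fock fock _ (fockX i) (fockX_lin i).
HB.instance Definition _ i := GRing.isLinear.Build K fock fock _ (fockD i) (fockD_lin i).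

Lemma fockD_X i j v : fockD i (fockX j v) = fockX j (fockD i v) + (i == j)%:R *: v.
Proof. by apply: val_inj; exact: derX_mulX. Qed.

Lemma fockD_comm i j v : fockD i (fockD j v) = fockD j (fockD i v).
Proof. by apply: val_inj; exact: derX_comm. Qed.

Lemma fockX_comm i j v : fockX i (fockX j v) = fockX j (fockX i v).
Proof. by apply: val_inj; exact: mulX_comm. Qed.

Lemma fockD_1 i : fockD i fock1 = 0.
Proof. by apply: val_inj; exact: derX_1. Qed.

Lemma fockD_trunc i v : evz (fun n => fockD (i, n) v).
Proof.
elim/fock_ind: v => [|k u v Hu Hv|[j p] v [N Hv]].
- by exists 0%N => n _; rewrite fockD_1.
- have [N z] := evz_lin k Hu Hv; exists N => n /z <-.
  by rewrite linearP.
- exists (maxn N p.+1) => n; rewrite geq_max => /andP[le lt].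
  rewrite fockD_X Hv // linear0 add0r xpair_eqE.
  by rewrite (gtn_eqF lt) andbF scale0r.
Qed.

Definition dualgen (i : bool * bool) : bool * bool := (i.1, ~~ i.2).
Definition gensign (i : bool * bool) : K := if i.2 then 1 else - 1.

(** Mode n >= 0 pairs with mode -n-1 of the dual generator, hence it is, up to sign, the derivative
    in the dual variable with the same index n. *)
Definition bgfield (i : bool * bool) (n : int) (v : fock) : fock :=
  match n with
  | Posz n => gensign i *: fockD (dualgen i, n) v
  | Negz n => fockX (i, n) v
  end.

Lemma bgfield_fld i : fld (bgfield i).
Proof.
split=> [[n|n] k u v|v] /=.
- by rewrite linearP /=; lmod.
- by rewrite linearP.
- have [N z] := fockD_trunc (dualgen i) v.
  by exists N => n /z ->; rewrite scaler0.
Qed.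

Lemma dualgenK : involutive dualgen.
Proof. by case=> e s; rewrite /dualgen /= negbK. Qed.

Lemma bgfield_com i j m l v : bgfield i m (bgfield j l v) =
  bgfield j l (bgfield i m v)
  + (if (j == dualgen i) && (m + l == - 1) then gensign i else 0) *: v.
Proof.
have sgnd : gensign (dualgen i) = - gensign i.
  by rewrite /gensign /=; case: (i.2); rewrite ?opprK.
case: m l => m [l|l] /=.
- by rewrite andbF scale0r addr0 !linearZ /= fockD_comm scalerA mulrC -scalerA.
- rewrite fockD_X linearZ /= scalerDr scalerA xpair_eqE; congr (_ + _ *: v).
  rewrite [dualgen i == j]eq_sym; case: (j == _) => /=; last by rewrite mulr0.
  have -> : (m%:Z + Negz l == - 1) = (m == l) by lia.
  by case: (m == l); rewrite ?mulr1 ?mulr0.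
- rewrite fockD_X linearZ /= scalerDr scalerA xpair_eqE.
  have -> : (Negz m + l%:Z == - 1) = (l == m) by lia.
  have [->|ji] := eqVneq j (dualgen i).
    rewrite dualgenK eqxx sgnd /=.
    by case: (l == m); rewrite ?mulr1 ?mulr0; lmod.
  case: eqVneq => [di|_] /=; last by rewrite mulr0 !scale0r !addr0.
  by rewrite -di dualgenK eqxx in ji.
- by rewrite andbF scale0r addr0 fockX_comm.
Qed.

Lemma bgfield_local i j : local (bgfield i) (bgfield j).
Proof.
exists 1%N => v; apply: funext => m; apply: funext => l.
have cE m' l' : com (bgfield i) (bgfield j) v m' l' =
    (if (j == dualgen i) && (m' + l' == - 1) then gensign i else 0) *: v.
  by rewrite /com bgfield_com addrC addKr.
by rewrite /= /diff2 !cE addrAC addrA subrr.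
Qed.

Lemma bgfield_vac i (n : nat) : bgfield i n%:Z fock1 = 0.
Proof. by rewrite /= fockD_1 scaler0. Qed.

(** The derivation of the polynomial ring that sends X_(i, n) to (n + 1) X_(i, n+1), as translation
    must do on creation modes. *)
Definition translate1 i v := ssum (fun n => n.+1%:R *: fockX (i, n.+1) (fockD (i, n) v)).
Definition translate v := \sum_i translate1 i v.

Lemma translate1_ev i v : evz (fun n => n.+1%:R *: fockX (i, n.+1) (fockD (i, n) v)).
Proof.
apply: evzZ; have [N z] := fockD_trunc i v.
by exists N => n /z ->; rewrite linear0.
Qed.

Lemma translate_lin : linear translate.
Proof.
move=> k u v; rewrite /translate scaler_sumr -big_split; apply: eq_bigr => i _ /=.
rewrite /translate1 -ssum_lin; try exact: translate1_ev.
by apply: eq_ssum => n; rewrite !linearP /=; lmod.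
Qed.

Lemma ssum_delta (p : nat) (f : nat -> fock) :
  ssum (fun n => (n == p)%:R *: f n) = f p.
Proof.
rewrite (@ssumE _ _ _ p.+1) => [|n lt]; last by rewrite gtn_eqF ?scale0r.
rewrite big_ord_recr /= eqxx scale1r big1 ?add0r // => n _.
by rewrite ltn_eqF ?scale0r.
Qed.

Lemma evz_delta (p : nat) (f : nat -> fock) : evz (fun n => (n == p)%:R *: f n).
Proof. by exists p.+1 => n lt; rewrite gtn_eqF ?scale0r. Qed.

Lemma sum_delta j (f : bool * bool -> fock) : \sum_i (i == j)%:R *: f i = f j.
Proof.
rewrite (bigD1 j) //= eqxx scale1r big1 ?addr0 // => i /negPf ->.
by rewrite scale0r.
Qed.

Lemma translate_X j p v :
  translate (fockX (j, p) v) = fockX (j, p) (translate v) + p.+1%:R *: fockX (j, p.+1) v.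
Proof.
rewrite /translate linear_sum -(sum_delta j (fun i => p.+1%:R *: fockX (i, p.+1) v)).
rewrite -big_split; apply: eq_bigr => i _ /=; rewrite /translate1.
have [N z] := translate1_ev i v.
transitivity (ssum (fun n => 1 *: fockX (j, p) (n.+1%:R *: fockX (i, n.+1) (fockD (i, n) v))
   + (n == p)%:R *: ((i == j)%:R *: (n.+1%:R *: fockX (i, n.+1) v)))).
  apply: eq_ssum => n; rewrite fockD_X linearD !linearZ /= xpair_eqE fockX_comm.
  by case: (i == j); case: (n == p); rewrite /= ?scale0r ?scaler0 ?addr0 ?scale1r ?scalerDr.
rewrite (ssum_lin 1) ?scale1r.
- rewrite (ssum_delta p (fun n => (i == j)%:R *: (n.+1%:R *: fockX (i, n.+1) v))); congr (_ + _).
  rewrite (ssumE z) linear_sum (@ssumE _ _ _ N) // => n /z ->.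
  exact: linear0.
- by exists N => n /z ->; rewrite linear0.
- exact: evz_delta.
Qed.

Lemma translate_D j p v : translate (fockD (j, p) v) =
  fockD (j, p) (translate v) - (if p is p'.+1 then p%:R *: fockD (j, p') v else 0).
Proof.
pose w i : fock := if p is p'.+1 then p%:R *: fockD (i, p') v else 0.
rewrite -/(w j) /translate linear_sum -(sum_delta j w) -sumrB.
apply: eq_bigr => i _ /=; rewrite /translate1.
have [N z] := translate1_ev i v.
transitivity (ssum (fun n => 1 *: fockD (j, p) (n.+1%:R *: fockX (i, n.+1) (fockD (i, n) v))
   + - ((n.+1 == p)%:R *: ((i == j)%:R *: (n.+1%:R *: fockD (i, n) v))))).
  apply: eq_ssum => n; rewrite linearZ /= fockD_X fockD_comm.
  rewrite xpair_eqE [p == _]eq_sym [j == _]eq_sym.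
  by case: (i == j); case: (_ == p); rewrite /= ?scale0r ?scaler0; lmod.
have edel : evz (fun n => - ((n.+1 == p)%:R *: ((i == j)%:R *: (n.+1%:R *: fockD (i, n) v)))).
  by exists p => n lt; rewrite gtn_eqF ?scale0r ?oppr0.
rewrite (ssum_lin 1) ?scale1r //.
- congr (_ + _); last first.
    rewrite /w; case: (p) => [|q].
      by rewrite scaler0 oppr0 ssum0 // => n; rewrite scale0r oppr0.
    rewrite -(ssum_delta q (fun n => - ((i == j)%:R *: (n.+1%:R *: fockD (i, n) v)))).
    by apply: eq_ssum => n; rewrite eqSS scalerN.
  rewrite (ssumE z) linear_sum (@ssumE _ _ _ N) // => n /z ->.
  exact: linear0.
- by exists N => n /z ->; rewrite linear0.
Qed.

Lemma translate_1 : translate fock1 = 0.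
Proof.
rewrite /translate big1 // => i _; rewrite /translate1 ssum0 // => n.
by rewrite fockD_1 linear0 scaler0.
Qed.

Lemma translateZ k v : translate (k *: v) = k *: translate v.
Proof.
have t0 : translate 0 = 0.
  by have := translate_lin (- 1) 0 0; rewrite scaler0 addr0 scaleN1r addNr.
by have := translate_lin k v 0; rewrite t0 !addr0.
Qed.

Lemma bgfield_cov i : covariant translate (bgfield i).
Proof.
move=> [[|n]|n] v.
- by rewrite /= translateZ translate_D; lmod.
- have -> : n.+1%:Z - 1 = n by lia.
  by rewrite /= translateZ translate_D; lmod.
- have -> : Negz n - 1 = Negz n.+1 by lia.
  by rewrite /= translate_X NegzE; lmod.
Qed.

Lemma bgfield_span (P : fock -> Prop) : P fock1 ->
  (forall k u v, P u -> P v -> P (k *: u + v)) ->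
  (forall i n v, P v -> P (bgfield i n v)) -> forall v, P v.
Proof.
move=> P1 Plin Pg; apply: fock_ind => // -[i n] v Pv.
exact: (Pg i (Negz n)).
Qed.

Definition fock_mode : fock -> int -> fock -> fock :=
  state_field translate_lin bgfield_fld bgfield_vac bgfield_cov bgfield_span.

Lemma fock_mode_fld a : fld (fock_mode a).
Proof.
exact: (state_field_fld translate_lin bgfield_fld bgfield_vac
  bgfield_cov bgfield_span).
Qed.

Lemma fock_modeP a :
  admissible fock1 translate (fock_mode a) /\ fock_mode a (- 1) fock1 = a.
Proof.
have [ua ea] :=
  state_fieldP translate_lin bgfield_fld bgfield_vac bgfield_cov bgfield_span a.
by split=> //; exact: (genfield_admissible translate_lin bgfield_fld
  bgfield_vac bgfield_cov).
Qed.

Lemma fock_mode_linearl (n : int) b : linear (fun a => fock_mode a n b).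
Proof.
move=> k u v; rewrite /fock_mode.
by rewrite (state_field_lin translate_lin translate_1 bgfield_fld bgfield_local).
Qed.

Lemma fock_mode_vacl (n : int) a : fock_mode fock1 n a = if n == - 1 then a else 0.
Proof.
rewrite /fock_mode.
by rewrite (state_field_vac translate_lin translate_1 bgfield_fld bgfield_local).
Qed.

Lemma fock_mode_gen i : fock_mode (bgfield i (- 1) fock1) = bgfield i.
Proof.
exact: (state_field_g translate_lin translate_1 bgfield_fld bgfield_local).
Qed.

Lemma fock_borcherds (a b c : fock) (m n l : int) (N : nat) :
  (forall j : nat, (N <= j)%N ->
     [/\ fock_mode a (n + j%:Z) b = 0, fock_mode b (l + j%:Z) c = 0 &
         fock_mode a (m + j%:Z) c = 0]) ->
  \sum_(j < N) binz K m j *: fock_mode (fock_mode a (n + j%:Z) b) (m + l - j%:Z) c =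
  \sum_(j < N) ((- 1) ^+ j * binz K n j) *:
      (fock_mode a (m + n - j%:Z) (fock_mode b (l + j%:Z) c)
       - (- 1) ^ n *: fock_mode b (n + l - j%:Z) (fock_mode a (m + j%:Z) c)).
Proof.
move=> z.
have := state_field_borcherds translate_lin translate_1 bgfield_fld bgfield_local
  bgfield_vac bgfield_cov bgfield_span a b c m n l.
have f0 d i : fock_mode d i 0 = 0 := fld0 i (fock_mode_fld d).
have fl0 i d : fock_mode 0 i d = 0.
  by have := fock_mode_linearl i d (- 1) 0 0; rewrite scaler0 addr0 scaleN1r addNr.
rewrite /res -/fock_mode /csum /asum.
rewrite (@ssumE _ _ _ N) => [->|j /z[-> _ _]]; last by rewrite fl0 scaler0.
rewrite (@ssumE _ _ _ N) => [|j /z[_ -> _]]; last by rewrite f0 scaler0.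
rewrite (@ssumE _ _ _ N) => [|j /z[_ _ ->]]; last by rewrite f0 scaler0.
rewrite scaler_sumr -sumrB; apply: eq_bigr => j _.
by rewrite /sbinz; lmod.
Qed.

HB.instance Definition _ := isVertexAlgebra.Build K fock fock_mode_linearl
  (fun a n => (fock_mode_fld a).1 n) (fun a b => (fock_mode_fld a).2 b)
  fock_mode_vacl (fun a => (fock_modeP a).2)
  (fun a n => let: And3 _ va _ := (fock_modeP a).1 in va n) fock_borcherds.

End Fock.

(** * Calculus in a vertex algebra *)

(* The name is shadowed by the derivative of polynomials. *)
Local Notation deriv := Defs.deriv.

Section VertexCalculus.
Variables (K : numFieldType) (V : vertexAlgType K).
Implicit Types (a b c u v p q r : V) (m n l : int) (s : seq V).

Lemma mode_fld a : fld (mode a).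
Proof. by split=> [n|v]; [exact: mode_linearr|exact: mode_trunc]. Qed.

Lemma mode0r a n : mode a n 0 = 0. Proof. exact: fld0 (mode_fld a). Qed.
Lemma modeDr a n u v : mode a n (u + v) = mode a n u + mode a n v.
Proof. exact: fldD (mode_fld a). Qed.
Lemma modeZr a n k v : mode a n (k *: v) = k *: mode a n v.
Proof. exact: fldZ (mode_fld a). Qed.
Lemma modeNr a n v : mode a n (- v) = - mode a n v.
Proof. by rewrite -scaleN1r modeZr scaleN1r. Qed.

Lemma modeDl a b n v : mode (a + b) n v = mode a n v + mode b n v.
Proof. by have := mode_linearl n v 1 a b; rewrite !scale1r. Qed.
Lemma mode0l n v : mode (0 : V) n v = 0.
Proof. by apply: (addrI (mode (0 : V) n v)); rewrite -modeDl !addr0. Qed.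
Lemma modeZl k a n v : mode (k *: a) n v = k *: mode a n v.
Proof. by have := mode_linearl n v k a 0; rewrite mode0l !addr0. Qed.
Lemma modeNl a n v : mode (- a) n v = - mode a n v.
Proof. by rewrite -scaleN1r modeZl scaleN1r. Qed.

Definition modeE := (modeDl, modeDr, modeZl, modeZr, modeNl, modeNr, mode0l, mode0r).

Lemma mode_vac a (n : nat) : mode a n%:Z vac = 0. Proof. exact: mode_vacr_ge0. Qed.

Lemma mode_evz a m v : evz (fun j : nat => mode a (m + j%:Z) v).
Proof. exact: evz_fld (mode_fld a). Qed.

(** A bound beyond [N0] lets a prescribed number of leading terms be split off before the vanishing
    ones are dropped. *)
Lemma borcherds_large a b c m n l (N0 : nat) : exists N, (N0 <= N)%N /\
  \sum_(j < N) binz K m j *: mode (mode a (n + j%:Z) b) (m + l - j%:Z) c =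
  \sum_(j < N) ((- 1) ^+ j * binz K n j) *:
      (mode a (m + n - j%:Z) (mode b (l + j%:Z) c)
       - (- 1) ^ n *: mode b (n + l - j%:Z) (mode a (m + j%:Z) c)).
Proof.
have [N1 z1] := mode_evz a n b; have [N2 z2] := mode_evz b l c.
have [N3 z3] := mode_evz a m c; exists (maxn N0 (maxn N1 (maxn N2 N3))).
split; first exact: leq_maxl.
apply: borcherds => j; rewrite !geq_max => /and4P[_ l1 l2 l3].
by split; [exact: z1|exact: z2|exact: z3].
Qed.

Lemma big_nat_widen0 (f : nat -> V) N1 N2 : (N1 <= N2)%N ->
  (forall j, (N1 <= j)%N -> f j = 0) -> \sum_(j < N2) f j = \sum_(j < N1) f j.
Proof.
move=> le f0; rewrite -(ssumE f0); symmetry; apply: ssumE => j lt.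
by rewrite f0 // (leq_trans le).
Qed.

Lemma mode_com a b s : OPE a b s -> forall m l c,
  mode a m (mode b l c) = mode b l (mode a m c)
  + \sum_(j < size s) binz K m j *: mode s`_j (m + l - j%:Z) c.
Proof.
move=> ope m l c; have [N [le]] := borcherds_large a b c m 0 l (size s).+1.
case: N le => [//|N] le.
under eq_bigr do rewrite add0r ope.
rewrite (@big_nat_widen0 (fun j => binz K m j *: mode s`_j (m + l - j%:Z) c) (size s)) => [->||j lt].
- rewrite big_ord_recl big1 => [|j _]; last by rewrite binz_0l mulr0 scale0r.
  by rewrite binz0 mul1r !scale1r /= !(subr0, addr0, add0r); lmod.
- exact: ltnW.
- by rewrite nth_default // mode0l scaler0.
Qed.

Lemma mode_com_nil a b m l c : OPE a b [::] ->
  mode a m (mode b l c) = mode b l (mode a m c).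
Proof. by move/mode_com ->; rewrite big_ord0 addr0. Qed.

Lemma mode_com1 a b p m l c : OPE a b [:: p] ->
  mode a m (mode b l c) = mode b l (mode a m c) + mode p (m + l) c.
Proof. by move/mode_com ->; rewrite big_ord1 binz0 scale1r subr0. Qed.

Lemma mode_com2 a b p q m l c : OPE a b [:: p; q] ->
  mode a m (mode b l c) = mode b l (mode a m c) + mode p (m + l) c
  + m%:~R *: mode q (m + l - 1) c.
Proof.
move/mode_com ->; rewrite big_ord_recl big_ord1 binz0 binz1 scale1r subr0.
by rewrite addrA.
Qed.

Lemma mode_com3 a b p q r m l c : OPE a b [:: p; q; r] ->
  mode a m (mode b l c) = mode b l (mode a m c) + mode p (m + l) c
  + m%:~R *: mode q (m + l - 1) c + binz K m 2 *: mode r (m + l - 2) c.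
Proof.
move/mode_com ->; rewrite 2!big_ord_recl big_ord1 binz0 binz1 scale1r subr0.
by rewrite !addrA.
Qed.

Lemma mode_0_mode a b n c :
  mode a 0 (mode b n c) = mode (mode a 0 b) n c + mode b n (mode a 0 c).
Proof.
have [N [le]] := borcherds_large a b c 0 0 n 1.
case: N le => [//|N] _; rewrite !big_ord_recl !big1 => [|j _|j _].
- by rewrite !binz0 mul1r !scale1r /= !(add0r, subr0, addr0) => ->; lmod.
- by rewrite binz_0l mulr0 scale0r.
- by rewrite binz_0l scale0r.
Qed.

Lemma mode_nop a b l c (N : nat) :
  (forall j : nat, (N <= j)%N -> mode b (l + j%:Z) c = 0 /\ mode a j%:Z c = 0) ->
  mode (mode a (- 1) b) l c = \sum_(j < N)
    (mode a (- 1 - j%:Z) (mode b (l + j%:Z) c) + mode b (l - 1 - j%:Z) (mode a j%:Z c)).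
Proof.
move=> z; have [N' [le]] := borcherds_large a b c 0 (- 1) l N.+1.
case: N' le => [//|N'] le; rewrite big_ord_recl big1 => [|j _]; last first.
  by rewrite binz_0l scale0r.
rewrite binz0 scale1r !(addr0, add0r, subr0) => ->.
pose f (j : nat) := mode a (- 1 - j%:Z) (mode b (l + j%:Z) c)
  + mode b (l - 1 - j%:Z) (mode a j%:Z c).
rewrite -[RHS](@big_nat_widen0 f N N'.+1) => [||j /z[e1 e2]]; first last.
- by rewrite /f e1 e2 !mode0r addr0.
- exact: ltnW.
apply: eq_bigr => j _; rewrite binz_N1l -expr2 sqrr_sign scale1r /f add0r.
by rewrite exprN1 invrN1 scaleN1r opprK [- 1 + l]addrC.
Qed.

Lemma mode_deriv a n c : mode (deriv a) n c = - n%:~R *: mode a (n - 1) c.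
Proof.
rewrite /deriv; have [N [le]] := borcherds_large a vac c 0 (- 2) n (absz n).+2.
case: N le => [//|N] le; rewrite big_ord_recl big1 => [|j _]; last first.
  by rewrite binz_0l scale0r.
rewrite binz0 scale1r !(addr0, add0r, subr0) => ->.
have cE (j : nat) : (- 1) ^+ j * binz K (- 2) j = j.+1%:R.
  elim: j => [|j IHj]; first by rewrite binz0 mul1r.
  have := binzS K (- 2) j; rewrite (_ : - 2 + 1 = - 1) // binz_N1l => e.
  have := congr1 ( *%R ((- 1) ^+ j.+1)) e.
  rewrite -expr2 sqrr_sign mulrDr {2}exprS mulN1r mulNr IHj => /eqP.
  by rewrite -subr_eq => /eqP <-; ring.
pose f (j : nat) := (j.+1%:R : K) *: (mode a (- 2 - j%:Z) (mode vac (n + j%:Z) c)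
  - mode vac (- 2 + n - j%:Z) (mode a j%:Z c)).
have sq : (- 1 : K) ^ (- 2) = 1.
  by rewrite -[LHS]/(((- 1) ^+ 2)^-1) sqrrN expr1n invr1.
transitivity (\sum_(j < N.+1) f j).
  by apply: eq_bigr => j _; rewrite cE /f sq scale1r add0r.
(* The vacuum acts as the identity in mode -1 only, so a single j contributes: j = -n-1 in the first
   term if n < 0, j = n-1 in the second if n > 0. *)
have fE (j : nat) : f j =
    if (j%:Z == n - 1) || (j%:Z == - n - 1) then - n%:~R *: mode a (n - 1) c else 0.
  rewrite /f !mode_vacl; have [jn|jn] := eqVneq j%:Z (n - 1).
    rewrite ifF; last by lia.
    rewrite ifT; last by lia.
    have nj : n%:~R = j.+1%:R :> K by rewrite (_ : n = j.+1%:Z) //; lia.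
    by rewrite jn mode0r nj /=; lmod.
  have [jn'|jn'] := eqVneq j%:Z (- n - 1).
    rewrite ifT; last by lia.
    rewrite ifF; last by lia.
    rewrite (_ : - 2 - j%:Z = n - 1); last by lia.
    have nj : - n%:~R = j.+1%:R :> K.
      by rewrite (_ : n = - j.+1%:Z) ?mulrNz ?opprK //; lia.
    by rewrite /= nj subr0.
  rewrite ifF; last by lia.
  rewrite ifF; last by lia.
  by rewrite mode0r /= subrr scaler0.
under eq_bigr do rewrite fE.
have [->|n0] := eqVneq n 0.
  have -> : - 0%:~R = 0 :> K by rewrite mulr0z oppr0.
  by rewrite scale0r big1 // => j _; rewrite scale0r; case: ifP.
have lt : ((absz n).-1 < N.+1)%N by lia.
rewrite (bigD1 (Ordinal lt)) //= ifT; last by lia.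
rewrite big1 ?addr0 // => j; rewrite -val_eqE /= => jn.
by rewrite ifF //; lia.
Qed.

Lemma deriv_mode a n b : deriv (mode a n b) = mode a n (deriv b) - n%:~R *: mode a (n - 1) b.
Proof.
rewrite /deriv; have [N [le]] := borcherds_large a b vac 0 n (- 2) 2.
case: N le => [//|[//|N]] _; rewrite big_ord_recl big1 => [|j _]; last first.
  by rewrite binz_0l scale0r.
rewrite binz0 scale1r !(addr0, add0r, subr0) => ->.
rewrite 2!big_ord_recl big1 => [|j _]; last first.
  rewrite (_ : - 2 + _ = j%:Z); last by rewrite /= /bump; lia.
  by rewrite add0r !mode_vac !mode0r !(subr0, scaler0).
rewrite /= /bump /= addn0 !add0r (_ : - 2 + 1%N%:Z = - 1) // !mode_vac !mode0r.
by rewrite binz0 binz1 mode_vacr subr0 addr0; lmod.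
Qed.

Lemma mode_vac_neq n v : n != - 1 -> mode vac n v = 0.
Proof. by rewrite mode_vacl => /negPf ->. Qed.

Lemma mode_derivr a n b :
  mode a n (deriv b) = deriv (mode a n b) + n%:~R *: mode a (n - 1) b.
Proof. by rewrite deriv_mode; lmod. Qed.

Lemma derivD a b : deriv (a + b) = deriv a + deriv b. Proof. exact: modeDl. Qed.
Lemma derivZ k a : deriv (k *: a) = k *: deriv a. Proof. exact: modeZl. Qed.
Lemma derivN a : deriv (- a) = - deriv a. Proof. exact: modeNl. Qed.
Lemma deriv_vac : deriv (vac : V) = 0. Proof. by rewrite /deriv mode_vacl. Qed.
Lemma deriv0 : deriv (0 : V) = 0. Proof. exact: mode0l. Qed.
Definition derivE := (derivD, derivZ, derivN, deriv_vac, deriv0).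

(** Skew-symmetry, with the divided derivatives of the s_i written as their modes on the vacuum;
    these vanish for i < n. *)
Lemma mode_skew a b s (n : nat) : OPE a b s ->
  mode b n%:Z a = - \sum_(i < size s) (- 1) ^+ i *: mode s`_i (n%:Z - 1 - i%:Z) vac.
Proof.
move=> /mode_com/(_ (- 1) n%:Z vac); rewrite mode_vac mode0r mode_vacr => /esym/eqP.
rewrite addr_eq0 => /eqP ->; congr (- _); apply: eq_bigr => i _.
by rewrite binz_N1l [- 1 + _]addrC.
Qed.

End VertexCalculus.

(** * Singular vectors *)

Section BershadskyPolyakov.
Variables (K : numFieldType) (k : K) (V : vertexAlgType K).

(** * Annihilation conditions for powers of G^+_(-1) *)

Section SingularVectors.
Variables (J T Gp Gm : V).
Hypothesis OPE_all : BP_OPEs k (BPFields J T Gp Gm).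

Local Notation v n := (iter n (mode Gp (- 1)) vac).

Let pole1 := 3 *: nop J J + (3 * (k + 1) / 2) *: deriv J - (k + 3) *: T.

Lemma Gp_power m n : mode Gp m%:Z (v n) = 0.
Proof.
have [_ [GpGp _] _ _ _] := OPE_all.
elim: n => [|n IHn]; first exact: mode_vac.
by rewrite iterS (mode_com_nil _ _ _ GpGp) IHn mode0r.
Qed.

Lemma J_power m n : mode J m%:Z (v n) = (if m == 0%N then n%:R else 0) *: v n.
Proof.
have [_ _ [JGp _] _ _] := OPE_all.
elim: n => [|n IHn]; first by rewrite mode_vac; case: ifP; rewrite scale0r.
rewrite iterS (mode_com1 _ _ _ JGp) IHn modeZr; case: m {IHn} => [|m] /=.
  by rewrite add0r -natr1; lmod.
by rewrite (_ : m.+1%:Z + - 1 = m) ?Gp_power; [lmod|lia].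
Qed.

Lemma T_mode_Gp m l u : mode T m (mode Gp l u) =
  mode Gp l (mode T m u) + (m%:~R / 2 - l%:~R) *: mode Gp (m + l - 1) u.
Proof.
have [_ _ _ _ [TGp _ _ _]] := OPE_all.
by rewrite (mode_com2 _ _ _ TGp) mode_deriv modeZl intrD; lmod.
Qed.

Lemma T_power m n : mode T m.+1%:Z (v n) = (if m == 0%N then 3 / 2 * n%:R else 0) *: v n.
Proof.
elim: n => [|n IHn]; first by rewrite mode_vac; case: ifP; rewrite ?mulr0 scale0r.
rewrite iterS T_mode_Gp IHn modeZr; case: m {IHn} => [|m] /=.
  by rewrite (_ : 1%N%:Z + - 1 - 1 = - 1) // -natr1; lmod.
by rewrite (_ : m.+2%:Z + - 1 - 1 = m) ?Gp_power; [lmod|lia].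
Qed.

Lemma Gp_com l m u : mode Gp l (mode Gp m u) = mode Gp m (mode Gp l u).
Proof. by have [_ [/mode_com_nil-> _] _ _ _] := OPE_all. Qed.

(** The modes of G^+ commute, so each of the n + 1 factors contributes the same vector. *)
Lemma T0_power n : mode T 0 (v n.+1) = n.+1%:R *: mode Gp (- 2) (v n).
Proof.
elim: n => [|n IHn]; rewrite iterS T_mode_Gp (_ : 0 + - 1 - 1 = - 2) //.
  by rewrite mode_vac mode0r; lmod.
by rewrite IHn modeZr Gp_com -iterS -[n.+2%:R]natr1; lmod.
Qed.

Lemma nop_JJ_power m n :
  mode (nop J J) m%:Z (v n) = mode J (- 1) (mode J m%:Z (v n)) + n%:R *: mode J (m%:Z - 1) (v n).
Proof.
rewrite /nop (@mode_nop _ _ _ _ _ _ 1) => [|[//|j] _].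
  by rewrite big_ord1 /= !(subr0, addr0) (J_power 0) modeZr.
by rewrite -PoszD !J_power addnS !scale0r.
Qed.

Lemma Gm_com m u : mode Gm m (mode Gp (- 1) u) = mode Gp (- 1) (mode Gm m u)
  - mode pole1 (m - 1) u + (3 * (k + 1)) *: mode J (m - 2) u
  - ((k + 1) * (2 * k + 3)) *: mode vac (m - 3) u.
Proof.
have [_ _ _ _ [_ _ _ /mode_com3-> ]] := OPE_all.
rewrite binz_N1l !modeZl [- 1 + m]addrC (_ : m - 1 - 1 = m - 2); last by lia.
by rewrite (_ : m - 1 - 2 = m - 3); [lmod|lia].
Qed.

Lemma Gm_power3 m n : mode Gm m.+3%:Z (v n) = 0.
Proof.
elim: n => [|n IHn]; first by rewrite mode_vac.
rewrite iterS Gm_com IHn mode0r.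
rewrite (_ : m.+3%:Z - 1 = m.+2); last by lia.
rewrite (_ : m.+3%:Z - 2 = m.+1); last by lia.
rewrite (_ : m.+3%:Z - 3 = m); last by lia.
rewrite mode_vacl /pole1 !modeE mode_deriv (_ : m.+2%:Z - 1 = m.+1); last by lia.
rewrite nop_JJ_power (_ : m.+2%:Z - 1 = m.+1); last by lia.
by rewrite !J_power T_power /= !scale0r !mode0r; lmod.
Qed.

(** Commuting G^-_2 past one more factor adds -3n^2 + (6k+9)n - (k+1)(2k+3) times the lower power;
    the partial sums of this quadratic factor as stated. *)
Lemma Gm_power2 n :
  mode Gm 2 (v n.+1) = - (n.+1%:R * (n%:R - k - 1) * (n%:R - 2 * k - 3)) *: v n.
Proof.
elim: n => [|n IHn]; first by rewrite /= Gm_com mode_vacl !mode_vac mode0r; lmod.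
rewrite iterS Gm_com IHn modeZr.
rewrite (_ : 2 - 1 = 1%N :> int) // (_ : 2 - 2 = 0%N :> int) // (_ : 2 - 3 = - 1 :> int) // mode_vacl.
rewrite /pole1 !modeE mode_deriv nop_JJ_power (_ : 1%N%:Z - 1 = 0%N) // !J_power T_power.
by rewrite /= modeE -[n.+2%:R]natr1 -[n.+1%:R]natr1; lmod.
Qed.

(** The induction closes because moving G^+_(-1) past J_(-1) and T_(0) creates only G^+_(-2), and
    [T0_power] brings T_(0) on the next power to the same vector. *)
Lemma Gm_power1 n : mode Gm 1 (v n.+1) =
  (n.+1%:R * (k + 1 - n%:R)) *: (3 *: mode J (- 1) (v n) - mode T 0 (v n)).
Proof.
have JGp u : mode Gp (- 1) (mode J (- 1) u) = mode J (- 1) (mode Gp (- 1) u) - mode Gp (- 2) u.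
  by have [_ _ [/mode_com1-> _] _ _] := OPE_all; rewrite (_ : - 1 + - 1 = - 2) //; lmod.
have TGp u : mode Gp (- 1) (mode T 0 u) = mode T 0 (mode Gp (- 1) u) - mode Gp (- 2) u.
  by rewrite T_mode_Gp (_ : 0 + - 1 - 1 = - 2) //; lmod.
elim: n => [|n IHn].
  rewrite /= Gm_com mode_vacl !mode_vac mode0r (_ : 1 - 2 = - 1 :> int) //.
  by rewrite (_ : 1 - 3 = - 2 :> int) //=; lmod.
rewrite iterS Gm_com IHn !modeE JGp TGp -!iterS.
rewrite (_ : 1 - 1 = 0%N :> int) // (_ : 1 - 2 = - 1 :> int) // (_ : 1 - 3 = - 2 :> int) // mode_vacl.
rewrite mode_deriv nop_JJ_power (_ : 0%N%:Z - 1 = - 1) // (J_power 0) modeZr.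
by rewrite T0_power -[n.+2%:R]natr1 -[n.+1%:R]natr1 /= mulr0z; lmod.
Qed.

Lemma singular_power n : n%:R = k + 2 -> v n <> 0 ->
  singular (BPFields J T Gp Gm) (v n).
Proof.
move=> nk vn0; split=> //.
- by exists n%:R; rewrite /Jm /= (J_power 0).
- by exists (3 / 2 * n%:R); rewrite /Lm /= (T_power 0).
case=> // -[//|m] _; rewrite /Jm /Lm /Gpm /Gmm /= J_power Gp_power.
rewrite -PoszD addn1 T_power !scale0r; split=> //.
have kn : k = n%:R - 2 by rewrite nk; ring.
case: n m nk vn0 kn => [|n] m; first by rewrite mode_vac.
rewrite -natr1 => _ _ kn; case: m => [|[|m]].
- by rewrite Gm_power1 kn; lmod.
- by rewrite Gm_power2 kn; lmod.
- exact: Gm_power3.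
Qed.

End SingularVectors.

Definition BP_swap (x : BPfields V) :=
  BPFields (- fJ x) (fT x) (fGm x) (- fGp x).

(** Exchanging two even fields negates the leading coefficient of the cubic pole; the minus sign in
    front of G^+ restores it, and J -> -J then repairs the double pole. *)
Lemma BP_OPEs_swap (x : BPfields V) : BP_OPEs k x -> BP_OPEs k (BP_swap x).
Proof.
case: x => J T Gp Gm [JJ [GpGp GmGm] [JGp JGm] TT [TGp TGm TJ GpGm]].
rewrite /BP_swap /=; split=> //.
- by move=> j; rewrite !modeE opprK JJ.
- by split=> // j; rewrite !modeE opprK GpGp.
- split=> j; rewrite !modeE ?JGm ?JGp ?opprK;
    by case: j => [|j]; rewrite /= ?nth_nil ?oppr0 ?opprK.
split=> // j.
- by rewrite !modeE TGp; case: j => [|[|j]] /=; rewrite ?derivE ?scalerN // ?nth_nil oppr0.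
- by rewrite !modeE TJ; case: j => [|[|j]] /=; rewrite ?derivE // ?nth_nil oppr0.
- rewrite modeE (mode_skew _ GpGm) 2!big_ord_recl big_ord1 /= expr0 expr1 sqrrN expr1n.
  case: j => [|[|[|j]]] /=.
  + rewrite (_ : 0%Z - 1 - 0%N%:Z = - 1) // (_ : 0%Z - 1 - 1%N%:Z = - 2) //.
    rewrite (_ : 0%Z - 1 - 2%N%:Z = - 3) // !mode_vacr /nop !modeE mode_vacl.
    by rewrite derivE -/(deriv J) /=; lmod.
  + rewrite (_ : 1%N%:Z - 1 - 0%N%:Z = 0%N) // (_ : 1%N%:Z - 1 - 1%N%:Z = - 1) //.
    by rewrite (_ : 1%N%:Z - 1 - 2%N%:Z = - 2) // mode_vac mode_vacr modeE mode_vacl /=; lmod.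
  + rewrite (_ : 2%N%:Z - 1 - 0%N%:Z = 1%N) // (_ : 2%N%:Z - 1 - 1%N%:Z = 0%N) //.
    by rewrite (_ : 2%N%:Z - 1 - 2%N%:Z = - 1) // !mode_vac mode_vacr; lmod.
  + rewrite (_ : j.+3%:Z - 1 - 0%N%:Z = j.+2); last by lia.
    rewrite (_ : j.+3%:Z - 1 - 1%N%:Z = j.+1); last by lia.
    rewrite (_ : j.+3%:Z - 1 - 2%N%:Z = j); last by lia.
    by rewrite !mode_vac nth_nil; lmod.
Qed.

End BershadskyPolyakov.

(** * Free field realisation *)

Section OPEFromBeta.
Variables (K : numFieldType) (k : K) (V : vertexAlgType K) (J T B G C : V).

Let X := 3 *: nop J J + (3 * (k + 1) / 2) *: deriv J - (k + 3) *: T.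
Let Y := (3 * (k + 1)) *: J.
Let Z := ((k + 1) * (2 * k + 3)) *: (vac : V).

Hypothesis JJ : OPE J J [:: 0; ((2 * k + 3) / 3) *: vac].
Hypothesis TT : OPE T T [:: deriv T; 2 *: T; 0; (BP_central_charge k / 2) *: vac].
Hypothesis TJ : OPE T J [:: deriv J; J].
Hypothesis BB : OPE B B [::].
Hypothesis JB : OPE J B [:: B].
Hypothesis TB : OPE T B [:: deriv B; (3 / 2) *: B].
Hypothesis BG : OPE B G [:: X; Y; Z].
Hypothesis T0 : forall v, mode T 0 v = deriv v.
Hypothesis CJ : mode C 0 J = 0.
Hypothesis CT : mode C 0 T = 0.
Hypothesis CG : mode C 0 G = - G.
Hypothesis B_faithful : forall (v : V) (c : nat), mode C 0 v = - c.+1%:R *: v ->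
  (forall m : nat, mode B m%:Z v = 0) -> v = 0.
Hypothesis k3 : k + 3 != 0.

Let JT : OPE J T [:: 0; J].
Proof.
move=> j; rewrite (mode_skew _ TJ) big_ord_recl big_ord1 /= expr0 expr1.
case: j => [|[|j]].
- by rewrite mode_vacr -/(deriv J) /=; lmod.
- by rewrite mode_vac mode_vacr /=; lmod.
- rewrite (_ : j.+2%:Z - 1 - 0 = j.+1); last by lia.
  rewrite (_ : j.+2%:Z - 1 - 1%N%:Z = j); last by lia.
  by rewrite !mode_vac /= nth_nil; lmod.
Qed.

Let JX : OPE J X [:: 0; Y; Z].
Proof.
move=> j; rewrite /X !modeE /nop (mode_com2 _ _ _ JJ) mode_derivr JT JJ.
case: j => [|[|[|j]]].
- by rewrite /= ?derivE !modeE; lmod.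
- by rewrite /= (JJ 0) !(modeE, derivE) mode_vacl mode_vacr /= /Y; lmod.
- by rewrite /= (JJ 1) !(modeE, derivE) mode_vac_neq //= /Z; lmod.
- rewrite /= !nth_nil (_ : j.+3%:Z - 1 = j.+2); last by lia.
  by rewrite JJ /= nth_nil !modeE derivE mode_vac_neq; [lmod|lia].
Qed.

Let TX : OPE T X [:: deriv X; 2 *: X; Y; (3 / 2) *: Z].
Proof.
move=> j; rewrite {1}/X !modeE /nop (mode_com2 _ _ _ TJ) mode_derivr mode_deriv TT !TJ.
case: j => [|[|[|[|j]]]].
- by rewrite /= /X /nop !derivE (deriv_mode J (- 1) J); lmod.
- by rewrite /= /X (TJ 0) /=; lmod.
- rewrite /= (TJ 1) (JJ 0) derivE !modeE /Y /=; lmod.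
(* The value of the central charge enters here: 2k+3 from :JJ: and (3k+1)(2k+3)/2 from T add up to
   3(k+1)(2k+3)/2. *)
- rewrite /= (TJ 2) (JJ 1) !(modeE, derivE) /Z /BP_central_charge /=; lmod.
- rewrite /= !nth_nil.
  rewrite (_ : j.+4%:Z - 1 = j.+3); last by lia.
  rewrite (_ : j.+3%:Z - 1 = j.+2); last by lia.
  by rewrite TJ JJ /= !nth_nil !modeE derivE; lmod.
Qed.

Let C_mode a n (v : V) (c d : K) : mode C 0 a = c *: a -> mode C 0 v = d *: v ->
  mode C 0 (mode a n v) = (c + d) *: mode a n v.
Proof. by move=> ca cv; rewrite mode_0_mode ca cv !modeE; lmod. Qed.

Let B_mode_eq0 m : mode B m.+3%:Z G = 0.
Proof. by rewrite BG /= nth_nil. Qed.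

Let TY (j : nat) : mode T j%:Z Y = [:: deriv Y; Y]`_j.
Proof.
by rewrite modeZr TJ; case: j => [|[|j]]; rewrite /= ?derivE // !nth_nil scaler0.
Qed.

Let JY (j : nat) : mode J j%:Z Y = [:: 0; Z]`_j.
Proof.
rewrite modeZr JJ; case: j => [|[|j]]; rewrite /= ?nth_nil ?scaler0 // /Z.
by lmod.
Qed.

Let aZ (a : V) (j : nat) : mode a j%:Z Z = 0.
Proof. by rewrite modeZr mode_vac scaler0. Qed.

(** The difference has charge -1, whence c = 0 in [B_faithful]. Applying b_(m) leaves the OPEs of J
    with the poles X, Y, Z, one case for each m <= 2. *)
Let JG : OPE J G [:: - G].
Proof.
move=> j; apply/eqP; rewrite -subr_eq0; apply/eqP; apply: (B_faithful (c := 0)).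
  have -> : mode J j%:Z G - [:: - G]`_j = mode J j%:Z G + [:: G]`_j.
    by case: j => [|j]; rewrite /= ?nth_nil ?subr0 ?addr0 ?opprK.
  rewrite modeE (C_mode _ (_ : _ = 0 *: J) (_ : _ = (- 1) *: G)) ?scale0r ?scaleN1r //.
  by case: j => [|j]; rewrite /= ?nth_nil ?modeE ?CG; lmod.
move=> m; have JBG := mode_com1 j%:Z m%:Z G JB.
have {JBG} -> : mode B m%:Z (mode J j%:Z G - [:: - G]`_j) =
    mode J j%:Z (mode B m%:Z G) - mode B (j + m)%N%:Z G - mode B m%:Z [:: - G]`_j.
  by rewrite !modeE JBG PoszD; lmod.
rewrite !BG; case: m => [|[|[|m]]].
- rewrite addn0 /= JX; case: j => [|[|[|j]]]; rewrite /= ?nth_nil ?modeE ?(BG 0) /=; lmod.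
- rewrite addn1 /= JY; case: j => [|[|j]]; rewrite /= ?nth_nil ?modeE ?(BG 1) /=; lmod.
- rewrite addn2 /= aZ; case: j => [|j]; rewrite /= ?nth_nil ?modeE ?(BG 2) /=; lmod.
- rewrite !addnS /= !nth_nil !modeE; case: j => [|j]; rewrite /= ?nth_nil ?modeE ?B_mode_eq0; lmod.
Qed.

Let TG : OPE T G [:: deriv G; (3 / 2) *: G].
Proof.
case=> [|j]; first exact: T0.
apply/eqP; rewrite -subr_eq0; apply/eqP; apply: (B_faithful (c := 0)).
  rewrite modeE (C_mode _ (_ : _ = 0 *: T) (_ : _ = (- 1) *: G)) ?scale0r ?scaleN1r //.
  by case: j => [|j]; rewrite /= ?nth_nil !modeE ?CG; lmod.
move=> m; have TBG := mode_com2 j.+1%:Z m%:Z G TB.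
have {TBG} -> : mode B m%:Z (mode T j.+1%:Z G - [:: deriv G; (3 / 2) *: G]`_j.+1) =
    mode T j.+1%:Z (mode B m%:Z G) - (j.+1%:R / 2 - m%:R) *: mode B (j + m)%N%:Z G
    - mode B m%:Z [:: deriv G; (3 / 2) *: G]`_j.+1.
  rewrite !modeE TBG mode_deriv modeE (_ : j.+1%:Z + m%:Z - 1 = (j + m)%N); last by lia.
  by rewrite intrD; lmod.
rewrite !BG; case: m => [|[|[|m]]].
- rewrite addn0 /= TX; case: j => [|[|[|j]]]; rewrite /= ?nth_nil ?modeE ?(BG 0) /=; lmod.
- rewrite addn1 /= TY; case: j => [|[|j]]; rewrite /= ?nth_nil ?modeE ?(BG 1) /=; lmod.
- rewrite addn2 /= aZ; case: j => [|j]; rewrite /= ?nth_nil ?modeE ?(BG 2) /=; lmod.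
- rewrite !addnS /= !nth_nil !modeE; case: j => [|j]; rewrite /= ?nth_nil ?modeE ?B_mode_eq0; lmod.
Qed.

(** The double pole cancels, since 3 + 3(k+1)/2 - 3(k+3)/2 = 0. With only a simple pole,
    skew-symmetry gives X_(j) G + G_(j) X = 0, which is what b_(0) G_(j) G amounts to in [GG]. *)
Let XG : OPE X G [:: - 6 *: mode J (- 1) G - (k + 3) *: deriv G].
Proof.
move=> j; rewrite /X !modeE mode_deriv TG /nop (@mode_nop _ _ _ _ _ _ 1) => [|i i0].
  rewrite big_ord1 /= !(subr0, addr0) (JG 0) !JG.
  case: j => [|[|j]].
  - by rewrite /= !modeE; lmod.
  - by rewrite /= !modeE (JG 0) /=; lmod.
  - rewrite (_ : j.+2%:Z - 1 = j.+1); last by lia.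
    by rewrite /= !(modeE, JG) /= !nth_nil; lmod.
by rewrite -PoszD !JG; case: i i0 => // i _; rewrite addnS /= !nth_nil.
Qed.

Let GG : OPE G G [::].
Proof.
have YG (j : nat) : mode Y j%:Z G = if j == 0%N then - (3 * (k + 1)) *: G else 0.
  by rewrite modeZl JG; case: j => [|j]; rewrite /= ?nth_nil ?scaler0 // scalerN scaleNr.
have GX (j : nat) : mode X j%:Z G + mode G j%:Z X = 0.
  rewrite (mode_skew _ XG) XG big_ord1 /= subr0 expr0.
  case: j => [|j]; first by rewrite mode_vacr /=; lmod.
  by rewrite (_ : j.+1%:Z - 1 = j) ?mode_vac /= ?nth_nil; [lmod|lia].
have GY (j : nat) : mode Y j%:Z G + mode G j%:Z Y = 0.
  rewrite YG modeZr (mode_skew _ JG) big_ord1 /= subr0 expr0.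
  case: j => [|j]; first by rewrite mode_vacr /=; lmod.
  by rewrite (_ : j.+1%:Z - 1 = j) ?mode_vac /=; [lmod|lia].
(* G_(j) G has charge -2. *)
move=> j; rewrite nth_nil; apply: (B_faithful (c := 1)).
  by rewrite (C_mode _ (_ : _ = (- 1) *: G) (_ : _ = (- 1) *: G)) ?scaleN1r //; lmod.
have XG0 (i : nat) : mode X i.+1%:Z G = 0 by rewrite XG /= nth_nil.
have ZG (i : nat) : mode Z i%:Z G = 0 by rewrite modeZl mode_vac_neq ?scaler0.
move=> m; rewrite (mode_com3 _ _ _ BG) BG; case: m => [|[|m]].
- by rewrite /= add0r binz_recr binz1 !mul0r !scale0r !addr0 addrC GX.
- rewrite (_ : 1%N%:Z + j%:Z = j.+1) // (_ : j.+1%:Z - 1 = j); last by lia.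
  rewrite /= XG0 binz_recr binz1 subrr mulr0 mul0r scale0r scale1r !addr0 addrC.
  exact: GY.
- rewrite (_ : m.+2%:Z + j%:Z = (m + j).+2) // (_ : (m + j).+2%:Z - 1 = (m + j).+1).
    rewrite (_ : (m + j).+2%:Z - 2 = (m + j)%N); last by lia.
    rewrite XG0 YG ZG /=; case: m => [|m] /=; rewrite ?aZ ?nth_nil ?mode0r; lmod.
  by lia.
Qed.

Lemma BP_OPEs_from_beta : BP_OPEs k (BPFields J T B G).
Proof. by []. Qed.

End OPEFromBeta.

(** * Currents and conformal vectors of a beta-gamma pair; the field G^- *)

Section BetaGammaPair.
Variables (K : numFieldType) (V : vertexAlgType K) (b c : V).
Hypothesis bc_com : forall m l (v : V),
  mode b m (mode c l v) = mode c l (mode b m v) + (m + l == - 1)%:R *: v.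
Hypothesis bb_com : forall m l (v : V), mode b m (mode b l v) = mode b l (mode b m v).
Hypothesis cc_com : forall m l (v : V), mode c m (mode c l v) = mode c l (mode c m v).

Lemma cb_com m l (v : V) :
  mode c m (mode b l v) = mode b l (mode c m v) - (l + m == - 1)%:R *: v.
Proof. by rewrite bc_com addrK. Qed.

Lemma OPE_commuting (x y : V) :
  (forall m l (v : V), mode x m (mode y l v) = mode y l (mode x m v)) -> OPE x y [::].
Proof.
by move=> com j; rewrite -[in LHS](mode_vacr y) com mode_vac mode0r nth_nil.
Qed.

Lemma OPE_bc : OPE b c [:: vac].
Proof.
move=> j; rewrite -[in LHS](mode_vacr c) bc_com mode_vac mode0r add0r.
rewrite (_ : (j%:Z - 1 == - 1) = (j == 0%N)); last by lia.
by case: j => [|j]; rewrite /= ?nth_nil ?scale1r ?scale0r.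
Qed.

Lemma OPE_cb : OPE c b [:: - vac].
Proof.
move=> j; rewrite -[in LHS](mode_vacr b) cb_com mode_vac mode0r sub0r.
rewrite (_ : (- 1 + j%:Z == - 1) = (j == 0%N)); last by lia.
by case: j => [|j]; rewrite /= ?nth_nil ?scale1r ?scale0r ?oppr0.
Qed.

(** On such a vector, nonnegative modes of :bc: and :bDc: need only the first one or two terms of
    [mode_nop]. *)
Let simple x := forall i : nat, mode b i.+1%:Z x = 0 /\ mode c i.+1%:Z x = 0.

Lemma simple_b : simple b.
Proof. by move=> i; rewrite (OPE_commuting bb_com) OPE_cb /= !nth_nil. Qed.

Lemma simple_c : simple c.
Proof. by move=> i; rewrite (OPE_commuting cc_com) OPE_bc /= !nth_nil. Qed.

Lemma current_simple x (j : nat) : simple x ->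
  mode (mode b (- 1) c) j%:Z x = mode b (- 1) (mode c j%:Z x) + mode c (j%:Z - 1) (mode b 0 x).
Proof.
move=> sx; rewrite (@mode_nop _ _ _ _ _ _ 1) => [|[//|i] _].
  by rewrite big_ord1 /= !(subr0, addr0).
by rewrite -PoszD addnS !(proj1 (sx _), proj2 (sx _)).
Qed.

Lemma conformal_simple x (j : nat) : simple x ->
  mode (mode b (- 1) (deriv c)) j%:Z x =
  - j%:R *: mode b (- 1) (mode c (j%:Z - 1) x) - j.+1%:R *: mode b (- 2) (mode c j%:Z x)
  - (j%:R - 1) *: mode c (j%:Z - 2) (mode b 0 x).
Proof.
move=> sx; rewrite (@mode_nop _ _ _ _ _ _ 2) => [|[//|[//|i]] _].
  rewrite big_ord_recl big_ord1 /= !mode_deriv (sx 0%N).1 !mode0r.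
  rewrite subr0 addr0 (_ : j%:Z + 1%N%:Z - 1 = j); last by lia.
  rewrite (_ : j%:Z - 1 - 0 - 1 = j%:Z - 2); last by lia.
  by rewrite !modeE subr0 /bump !intrD /=; lmod.
rewrite mode_deriv (_ : j%:Z + i.+2%:Z - 1 = (j + i).+1); last by lia.
by rewrite !(proj1 (sx _), proj2 (sx _)) scaler0.
Qed.

Lemma OPE_current_b : OPE (mode b (- 1) c) b [:: - b].
Proof.
move=> j; rewrite current_simple ?(OPE_commuting bb_com 0) //; last exact: simple_b.
rewrite OPE_cb; case: j => [|j]; rewrite /= ?nth_nil ?modeE ?mode_vacr; lmod.
Qed.

Lemma OPE_current_c : OPE (mode b (- 1) c) c [:: c].
Proof.
move=> j; rewrite current_simple ?(OPE_commuting cc_com) ?(OPE_bc 0); last exact: simple_c.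
rewrite /= nth_nil mode0r; case: j => [|j]; first by rewrite /= mode_vacr; lmod.
by rewrite (_ : j.+1%:Z - 1 = j) ?mode_vac /= ?nth_nil; [lmod|lia].
Qed.

Lemma OPE_conformal_b : OPE (mode b (- 1) (deriv c)) b [:: deriv b; b].
Proof.
move=> j; rewrite conformal_simple ?(OPE_commuting bb_com 0) ?OPE_cb; last exact: simple_b.
case: j => [|[|j]].
- by rewrite /= /deriv !modeE; lmod.
- by rewrite /= (OPE_cb 0) /= !modeE mode_vacr; lmod.
- rewrite (_ : j.+2%:Z - 1 = j.+1); last by lia.
  by rewrite OPE_cb /= ?nth_nil ?mode0r; lmod.
Qed.

Lemma OPE_conformal_c : OPE (mode b (- 1) (deriv c)) c [:: deriv c].
Proof.
move=> j; rewrite conformal_simple ?(OPE_commuting cc_com j) ?(OPE_bc 0); last exact: simple_c.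
rewrite nth_nil mode0r; case: j => [|[|j]].
- by rewrite /= /deriv; lmod.
- by rewrite /= (OPE_commuting cc_com 0) /= mode0r; lmod.
- rewrite (_ : j.+2%:Z - 1 = j.+1); last by lia.
  rewrite (_ : j.+2%:Z - 2 = j); last by lia.
  by rewrite (OPE_commuting cc_com) /= ?nth_nil mode0r mode_vac; lmod.
Qed.

Lemma OPE_pair_commuting x (y : V) : x = c \/ x = deriv c ->
  (forall m l (v : V), mode b m (mode y l v) = mode y l (mode b m v)) ->
  (forall m l (v : V), mode c m (mode y l v) = mode y l (mode c m v)) ->
  OPE (mode b (- 1) x) y [::].
Proof.
move=> xc bY cY.
have by0 (i : nat) : mode b i%:Z y = 0 by rewrite (OPE_commuting bY) nth_nil.
have cy0 (i : nat) : mode c i%:Z y = 0 by rewrite (OPE_commuting cY) nth_nil.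
have sy : simple y by move=> i; rewrite by0 cy0.
move=> j; case: xc => ->; first by rewrite current_simple // (by0 0) cy0 !mode0r nth_nil addr0.
rewrite conformal_simple // (by0 0) cy0 !mode0r nth_nil; case: j => [|j]; first by lmod.
by rewrite (_ : j.+1%:Z - 1 = j) ?cy0 ?mode0r; [lmod|lia].
Qed.

Section GMinus.
Variables (k : K) (j T' J T : V).
Hypothesis bj_com : forall m l (v : V), mode b m (mode j l v) = mode j l (mode b m v).
Hypothesis cj_com : forall m l (v : V), mode c m (mode j l v) = mode j l (mode c m v).
Hypothesis bT' : forall m : nat, mode b m%:Z T' = 0.
Hypothesis JE : J = - mode b (- 1) c + j.
Hypothesis TE : T = mode b (- 1) (deriv c) + (1 / 2) *: deriv (mode b (- 1) c) + T'.

(** The part of the simple pole of G^+ with G^- that is free of b and c. *)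
Definition Gminus_tail := 3 *: mode j (- 1) j + (3 * (k + 1) / 2) *: deriv j - (k + 3) *: T'.

(* The state determined by the requirement that b_(m) G^- be the coefficients of
   the OPE of G^+ = b with G^-: since b_(m) is the derivative with respect to
   c_(-m-1), it is obtained by integrating these coefficients. *)
Definition Gminus_state :=
  mode b (- 1) (mode b (- 1) (mode c (- 1) (mode c (- 1) c)))
  - (3 * (k + 1)) *: mode b (- 1) (mode c (- 2) c)
  - (k + 3) *: mode b (- 2) (mode c (- 1) c)
  - 3 *: mode b (- 1) (mode c (- 1) (mode c (- 1) j))
  + mode c (- 1) Gminus_tail + (3 * (k + 1)) *: mode c (- 2) j
  + ((k + 1) * (2 * k + 3)) *: mode c (- 3) vac.

Let b_j (m : nat) : mode b m%:Z j = 0.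
Proof. by rewrite (OPE_commuting bj_com) nth_nil. Qed.
Let c_j (m : nat) : mode c m%:Z j = 0.
Proof. by rewrite (OPE_commuting cj_com) nth_nil. Qed.
Let c_c (m : nat) : mode c m%:Z c = 0.
Proof. by rewrite (OPE_commuting cc_com) nth_nil. Qed.

Let b_tail (m : nat) : mode b m%:Z Gminus_tail = 0.
Proof.
rewrite /Gminus_tail !modeE bT' bj_com b_j mode_derivr b_j derivE mode0r.
case: m => [|m]; first by rewrite mulr0z; lmod.
by rewrite (_ : m.+1%:Z - 1 = m) ?b_j; [lmod|lia].
Qed.

Let c_n l : mode c l (mode b (- 1) c) = mode b (- 1) (mode c l c) - (l == 0)%:R *: c.
Proof. by rewrite cb_com (_ : (- 1 + l == - 1) = (l == 0)) //; lia. Qed.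

Let nop_nn : mode (mode b (- 1) c) (- 1) (mode b (- 1) c) =
  mode b (- 1) (mode b (- 1) (mode c (- 1) c))
  - mode b (- 2) c + mode b (- 1) (mode c (- 2) vac).
Proof.
rewrite (@mode_nop _ _ _ _ _ _ 2) => [|[//|[//|i]] _]; last first.
  have -> : - 1 + i.+2%:Z = i.+1 by lia.
  by rewrite c_n bb_com c_c OPE_bc /= ?nth_nil mode0r scale0r subr0.
rewrite big_ord_recl big_ord1.
transitivity (mode b (- 1) (mode c (- 1) (mode b (- 1) c))
  + mode c (- 2) (mode b 0%N (mode b (- 1) c))
  + (mode b (- 2) (mode c 0%N (mode b (- 1) c))
     + mode c (- 3) (mode b 1%N (mode b (- 1) c)))) => [//|].
rewrite !c_n (bb_com 0%N) (bb_com 1%N) !OPE_bc c_c /= (cb_com (- 2)) /= !modeE.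
by lmod.
Qed.

Let nop_nj : mode (mode b (- 1) c) (- 1) j = mode b (- 1) (mode c (- 1) j).
Proof.
rewrite (@mode_nop _ _ _ _ _ _ 1) => [|[//|i] _]; last first.
  by rewrite b_j (_ : - 1 + i.+1%:Z = i) ?c_j //; lia.
by rewrite big_ord1 /= b_j mode0r addr0.
Qed.

Let nop_jn : mode j (- 1) (mode b (- 1) c) = mode b (- 1) (mode c (- 1) j).
Proof. by rewrite -bj_com -[X in mode j _ X](mode_vacr c) -cj_com mode_vacr. Qed.

Lemma OPE_b_Gminus : OPE b Gminus_state
  [:: 3 *: nop J J + (3 * (k + 1) / 2) *: deriv J - (k + 3) *: T;
      (3 * (k + 1)) *: J; ((k + 1) * (2 * k + 3)) *: vac].
Proof.
have dn : deriv (mode b (- 1) c) = mode b (- 1) (deriv c) + mode b (- 2) c.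
  by rewrite deriv_mode (_ : - 1 - 1 = - 2 :> int) //; lmod.
rewrite /nop JE TE !modeE !derivE nop_nn nop_nj nop_jn dn /(deriv c).
move=> m; have b_b l v : mode b m%:Z (mode b l v) = mode b l (mode b m%:Z v) := bb_com m l v.
have b_c l v : mode b m%:Z (mode c l v) =
    mode c l (mode b m%:Z v) + (m%:Z + l == - 1)%:R *: v := bc_com m l v.
(* The tail is kept opaque while the modes of b act, which kill it, and is expanded only
   afterwards. *)
have := erefl Gminus_tail; rewrite {1}/Gminus_tail /Gminus_state.
move: Gminus_tail b_tail => tail b_tl tailE.
rewrite !modeE !b_b !b_c b_tl b_j mode_vac OPE_bc !modeE -tailE.
case: m {b_b b_c} => [|[|[|m]]].
- by rewrite /= ?modeE ?mode_vacr; lmod.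
- by rewrite /= ?modeE ?mode_vacr; lmod.
- by rewrite /= ?modeE ?mode_vacr; lmod.
- have eqF i : (m.+3%:Z - i.+1%:Z == - 1) = (m.+3 == i) by lia.
  by rewrite (eqF 0%N) (eqF 1%N) (eqF 2%N) /= ?nth_nil ?modeE; lmod.
Qed.

Hypothesis n_j : mode (mode b (- 1) c) 0 j = 0.
Hypothesis n_T' : mode (mode b (- 1) c) 0 T' = 0.

Lemma charge_Gminus : mode (mode b (- 1) c) 0 Gminus_state = Gminus_state.
Proof.
have nb l v : mode (mode b (- 1) c) 0 (mode b l v) =
    mode b l (mode (mode b (- 1) c) 0 v) - mode b l v.
  by rewrite (mode_com1 _ _ _ OPE_current_b) add0r modeNl.
have nc l v : mode (mode b (- 1) c) 0 (mode c l v) =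
    mode c l (mode (mode b (- 1) c) 0 v) + mode c l v.
  by rewrite (mode_com1 _ _ _ OPE_current_c) add0r.
have ntail : mode (mode b (- 1) c) 0 Gminus_tail = 0.
  by rewrite /Gminus_tail !modeE mode_0_mode n_j n_T' mode_derivr n_j derivE !modeE mulr0z; lmod.
rewrite /Gminus_state; move: Gminus_tail ntail => tail n_tail.
rewrite !modeE !(nb, nc) n_tail n_j (OPE_current_c 0) (mode_vac _ 0) /= !modeE.
by lmod.
Qed.

End GMinus.
End BetaGammaPair.

(** * The realisation by two beta-gamma pairs *)

Section Realisation.
Variables (K : numFieldType) (V : vertexAlgType K) (b c u d : V).

Local Notation commuting x y := (forall m l (v : V),
  mode x m (mode y l v) = mode y l (mode x m v)).
Local Notation dual x y := (forall m l (v : V),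
  mode x m (mode y l v) = mode y l (mode x m v) + (m + l == - 1)%:R *: v).

Hypothesis bc : dual b c.
Hypothesis ud : dual u d.
Hypotheses (bb : commuting b b) (cc : commuting c c) (uu : commuting u u)
  (dd : commuting d d) (bu : commuting b u) (bd : commuting b d)
  (cu : commuting c u) (cd : commuting c d).
Hypothesis span : forall P : V -> Prop, P vac ->
  (forall k v w, P v -> P w -> P (k *: v + w)) ->
  (forall x n v, x \in [:: b; c; u; d] -> P v -> P (mode x n v)) -> forall v, P v.

Let com_sym x y : commuting x y -> commuting y x.
Proof. by move=> xy m l v; rewrite xy. Qed.

Let com_deriv x y : commuting x y -> commuting x (deriv y).
Proof. by move=> xy m l v; rewrite !mode_deriv modeZr xy. Qed.

(** u and w are isotropic Heisenberg currents whose mutual OPE is (z-w)^(-2): the rank-two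
    Heisenberg algebra of the realisation. *)
Let w := deriv d.
Let n := mode b (- 1) c.
Let bw : commuting b w := com_deriv bd.
Let cw : commuting c w := com_deriv cd.

Let n_b : OPE n b [:: - b]. Proof. exact: OPE_current_b. Qed.
Let n_c : OPE n c [:: c]. Proof. exact: OPE_current_c. Qed.
Let n_u : OPE n u [::] := OPE_pair_commuting (or_introl erefl) bu cu.
Let n_w : OPE n w [::] := OPE_pair_commuting (or_introl erefl) bw cw.

(** The conformal vector of central charge 4 in which b and u have weight 1, c and d weight 0.
    Adding the derivative of a current will correct it to T. *)
Let t : V := mode b (- 1) (deriv c) + mode u (- 1) (deriv d).

Let t_add x s : OPE (mode b (- 1) (deriv c)) x s ->
  OPE (mode u (- 1) (deriv d)) x [::] -> OPE t x s.
Proof. by move=> h1 h2 j; rewrite modeDl h1 h2 nth_nil addr0. Qed.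

Let t_add' x s : OPE (mode b (- 1) (deriv c)) x [::] ->
  OPE (mode u (- 1) (deriv d)) x s -> OPE t x s.
Proof. by move=> h1 h2 j; rewrite modeDl h1 h2 nth_nil add0r. Qed.

Let t_b : OPE t b [:: deriv b; b].
Proof.
apply: t_add; first exact: OPE_conformal_b.
exact: (OPE_pair_commuting (or_intror erefl) (com_sym bu) (com_sym bd)).
Qed.
Let t_c : OPE t c [:: deriv c].
Proof.
apply: t_add; first exact: OPE_conformal_c.
exact: (OPE_pair_commuting (or_intror erefl) (com_sym cu) (com_sym cd)).
Qed.
Let t_u : OPE t u [:: deriv u; u].
Proof.
apply: t_add'; last exact: OPE_conformal_b.
exact: (OPE_pair_commuting (or_intror erefl) bu cu).
Qed.
Let t_d : OPE t d [:: deriv d].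
Proof.
apply: t_add'; last exact: OPE_conformal_c.
exact: (OPE_pair_commuting (or_intror erefl) bd cd).
Qed.

Let t_w : OPE t w [:: deriv w; w].
Proof.
move=> j; rewrite /w mode_derivr !t_d.
case: j => [|[|j]]; rewrite /= ?(t_d 0) /=; first by lmod.
  by rewrite derivE; lmod.
rewrite (_ : j.+2%:Z - 1 = j.+1); last by lia.
by rewrite t_d /= !nth_nil derivE; lmod.
Qed.

Let t_mode1 x l v : OPE t x [:: deriv x; x] ->
  forall m, mode t m (mode x l v) = mode x l (mode t m v) - l%:~R *: mode x (m + l - 1) v.
Proof. by move=> tx m; rewrite (mode_com2 _ _ _ tx) mode_deriv intrD; lmod. Qed.

Let t_mode0 x l v : OPE t x [:: deriv x] ->
  forall m, mode t m (mode x l v) = mode x l (mode t m v) - (m + l)%:~R *: mode x (m + l - 1) v.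
Proof. by move=> tx m; rewrite (mode_com1 _ _ _ tx) mode_deriv; lmod. Qed.

Let t_n : OPE t n [:: deriv n; n; vac].
Proof.
move=> j; rewrite /n (t_mode1 _ _ t_b) t_c; case: j => [|[|[|j]]].
- by rewrite /= (deriv_mode b) (_ : 0%N%:Z + - 1 - 1 = - 1 - 1) //; lmod.
- by rewrite /= (_ : 1%N%:Z + - 1 - 1 = - 1) // mode0r; lmod.
- rewrite /= mode0r (_ : 2%N%:Z + - 1 - 1 = 0%N) // (OPE_bc bc) /=; lmod.
- rewrite /= ?nth_nil mode0r (_ : j.+3%:Z + - 1 - 1 = j.+1); last by lia.
  by rewrite (OPE_bc bc) /= ?nth_nil; lmod.
Qed.

Let pair_t e f : dual e f -> OPE t e [:: deriv e; e] -> OPE t f [:: deriv f] ->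
  forall j : nat, mode t j%:Z (mode e (- 1) (deriv f)) =
    [:: deriv (mode e (- 1) (deriv f)); 2 *: mode e (- 1) (deriv f); 0; vac]`_j.
Proof.
move=> ef te tf j; have f_vac : deriv f = mode f (- 2) vac by [].
rewrite (t_mode1 _ _ te) f_vac (t_mode0 _ _ tf) mode_vac mode0r.
have ef0 (i l : nat) : mode e i%:Z (mode f (- l.+1%:Z) vac) = (i == l)%:R *: vac.
  by rewrite ef mode_vac mode0r add0r (_ : (_ == - 1) = (i == l)) //; lia.
case: j => [|[|[|[|j]]]].
- rewrite /= !deriv_mode deriv_vac (_ : 0%N%:Z + - 2 - 1 = - 2 - 1) //.
  by rewrite (_ : 0%N%:Z + - 1 - 1 = - 1 - 1) // !modeE; lmod.
- by rewrite /= (_ : 1%N%:Z + - 2 - 1 = - 2) // (_ : 1%N%:Z + - 1 - 1 = - 1) // !modeE; lmod.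
- rewrite /= (_ : 2%N%:Z + - 2 - 1 = - 1) // (_ : 2%N%:Z + - 1 - 1 = 0%N) // (ef0 0%N 1%N).
  by rewrite !modeE /=; lmod.
- rewrite /= (_ : 3%N%:Z + - 2 - 1 = 0%N) // (_ : 3%N%:Z + - 1 - 1 = 1%N) // (ef0 1%N 1%N).
  by rewrite mode_vac !modeE /=; lmod.
- rewrite (_ : j.+4%:Z + - 2 - 1 = j.+1); last by lia.
  rewrite (_ : j.+4%:Z + - 1 - 1 = j.+2); last by lia.
  by rewrite (ef0 j.+2 1%N) mode_vac /= ?nth_nil !modeE; lmod.
Qed.

Let t_t : OPE t t [:: deriv t; 2 *: t; 0; 2 *: vac].
Proof.
move=> j; rewrite {2}/t modeDr (pair_t bc t_b t_c) (pair_t ud t_u t_d) /t.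
by case: j => [|[|[|[|j]]]]; rewrite /= ?nth_nil ?derivE; lmod.
Qed.

(** Both sides kill the vacuum and have the same commutators with the modes of the generators. *)
Let t_0 v : mode t 0 v = deriv v.
Proof.
elim/span: v => [|a x y IHx IHy|x l y xs IHy].
- by rewrite (mode_vac t 0) deriv_vac.
- by rewrite modeDr modeZr derivD derivZ IHx IHy.
- rewrite deriv_mode -IHy; move: xs; rewrite !inE => /or4P[] /eqP->.
  + by rewrite (t_mode1 _ _ t_b) add0r.
  + by rewrite (t_mode0 _ _ t_c) add0r.
  + by rewrite (t_mode1 _ _ t_u) add0r.
  + by rewrite (t_mode0 _ _ t_d) add0r.
Qed.

Let cur (p q r : K) := p *: n + q *: u + r *: w.

Let n_n : OPE n n [:: 0; - vac].
Proof.
move=> j; rewrite {2}/n (mode_com1 _ _ _ n_b) n_c modeNl.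
case: j => [|[|j]].
- by rewrite /= (_ : 0 + - 1 = - 1 :> int) //; lmod.
- by rewrite /= mode0r (_ : 1%N%:Z + - 1 = 0%N) // (OPE_bc bc) /=; lmod.
- rewrite (_ : j.+2%:Z + - 1 = j.+1); last by lia.
  by rewrite (OPE_bc bc) /= ?nth_nil mode0r; lmod.
Qed.

Let u_n : OPE u n [::].
Proof.
by move=> j; rewrite /n -bu (OPE_commuting (com_sym cu)) !nth_nil mode0r.
Qed.

Let w_n : OPE w n [::].
Proof.
by move=> j; rewrite /n -bw (OPE_commuting (com_sym cw)) !nth_nil mode0r.
Qed.

Let u_w : OPE u w [:: 0; vac].
Proof.
move=> j; rewrite /w mode_derivr (OPE_bc ud).
case: j => [|[|j]]; first by rewrite /= derivE; lmod.
  by rewrite /= (OPE_bc ud 0) derivE /=; lmod.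
rewrite (_ : j.+2%:Z - 1 = j.+1); last by lia.
by rewrite (OPE_bc ud) /= ?nth_nil derivE; lmod.
Qed.

Let w_u : OPE w u [:: 0; vac].
Proof.
move=> j; rewrite /w mode_deriv.
case: j => [|[|j]]; first by rewrite /= mulr0z; lmod.
  by rewrite /= (OPE_cb ud 0) /=; lmod.
rewrite (_ : j.+2%:Z - 1 = j.+1); last by lia.
by rewrite (OPE_cb ud) /= ?nth_nil; lmod.
Qed.

Let w_w : OPE w w [::].
Proof.
move=> j; apply: OPE_commuting => m l v.
by rewrite !mode_deriv !modeZr dd; lmod.
Qed.

Let u_u : OPE u u [::] := OPE_commuting uu.

Let cur_cur p q r p' q' r' : OPE (cur p q r) (cur p' q' r')
  [:: 0; (q * r' + r * q' - p * p') *: vac].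
Proof.
move=> j; rewrite !modeE n_n n_u n_w u_n u_u u_w w_n w_u w_w.
by case: j => [|[|j]]; rewrite /= ?nth_nil; lmod.
Qed.

Let t_cur p q r : OPE t (cur p q r) [:: deriv (cur p q r); cur p q r; p *: vac].
Proof.
move=> j; rewrite !(modeDr, modeZr) t_n t_u t_w /cur.
by case: j => [|[|[|j]]]; rewrite /= ?nth_nil ?derivE; lmod.
Qed.

Let cur_t p q r : OPE (cur p q r) t [:: 0; cur p q r; - p *: vac].
Proof.
move=> j; rewrite (mode_skew _ (t_cur p q r)) 2!big_ord_recl big_ord1 /= expr0 expr1 sqrrN expr1n.
case: j => [|[|[|j]]] /=.
- rewrite (_ : 0%Z - 1 - 0%N%:Z = - 1) // (_ : 0%Z - 1 - 1%N%:Z = - 2) //.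
  rewrite (_ : 0%Z - 1 - 2%N%:Z = - 3) // mode_vacr modeZl mode_vacl.
  by rewrite -/(deriv (cur p q r)) /=; lmod.
- rewrite (_ : 1%N%:Z - 1 - 0%N%:Z = 0%N) // (_ : 1%N%:Z - 1 - 1%N%:Z = - 1) //.
  by rewrite (_ : 1%N%:Z - 1 - 2%N%:Z = - 2) // mode_vac mode_vacr modeZl mode_vacl /=; lmod.
- rewrite (_ : 2%N%:Z - 1 - 0%N%:Z = 1%N) // (_ : 2%N%:Z - 1 - 1%N%:Z = 0%N) //.
  by rewrite (_ : 2%N%:Z - 1 - 2%N%:Z = - 1) // !mode_vac modeZl mode_vacr; lmod.
- rewrite (_ : j.+3%:Z - 1 - 0%N%:Z = j.+2); last by lia.
  rewrite (_ : j.+3%:Z - 1 - 1%N%:Z = j.+1); last by lia.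
  rewrite (_ : j.+3%:Z - 1 - 2%N%:Z = j); last by lia.
  by rewrite !mode_vac nth_nil; lmod.
Qed.

Variables (k om : K).
Hypotheses (k3 : k + 3 != 0) (om2 : om ^+ 2 = - 3).

(* J has level 2 al - 1 = (2k + 3)/3; it is primary if r al + s = - 1, and the
   central charge is 13 - 24 r s. Solving for s brings in a square root of - 3. *)
Let al := (k + 3) / 3.
Let s := - (1 / 2) + (k + 2) * om / 6.
Let r := (- 3 - 3 * s) / (k + 3).
Let J := cur (- 1) 1 al.
Let h := cur (1 / 2) r s.
Let T := t + deriv h.

(** The value for which 13 - 24 r s is the required central charge. Together with r al + s = -1 it
    reads 12 s^2 + 12 s + k^2 + 4k + 7 = 0, with discriminant -48 (k+2)^2, that is -3 times the
    square of 4(k+2). *)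
Let r_s : r * s = (k ^+ 2 + 4 * k + 7) / (4 * (k + 3)).
Proof.
have -> : r * s = (- 3 * s - 3 * s ^+ 2) / (k + 3) by rewrite /r; field.
have -> : s ^+ 2 = 1 / 4 - (k + 2) * om / 6 + (k + 2) ^+ 2 * om ^+ 2 / 36.
  by rewrite /s; field.
by rewrite om2 /s; field.
Qed.

Let r_al : r * al = - 1 - s.
Proof. by rewrite /r /al; field. Qed.

Let T_mode (j : nat) x : mode T j%:Z x = mode t j%:Z x - j%:R *: mode h (j%:Z - 1) x.
Proof. by rewrite modeDl mode_deriv; lmod. Qed.

Let J_J : OPE J J [:: 0; ((2 * k + 3) / 3) *: vac].
Proof.
move=> j; rewrite cur_cur; congr (nth 0 [:: _; _] _); congr (_ *: _).
by rewrite /al; field.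
Qed.

Let h_h : OPE h h [:: 0; (2 * (r * s) - 1 / 4) *: vac].
Proof.
move=> j; rewrite cur_cur; congr (nth 0 [:: _; _] _); congr (_ *: _).
by field.
Qed.

Let h_J : OPE h J [:: 0; - (1 / 2) *: vac].
Proof.
move=> j; rewrite cur_cur; congr (nth 0 [:: _; _] _); congr (_ *: _).
by rewrite r_al; field.
Qed.

Let T_0 v : mode T 0 v = deriv v.
Proof. by rewrite (T_mode 0) t_0 scale0r subr0. Qed.

Let T_J : OPE T J [:: deriv J; J].
Proof.
move=> j; rewrite T_mode t_cur; case: j => [|[|[|j]]].
- by rewrite /=; lmod.
- by rewrite /= (h_J 0) /=; lmod.
(* J is primary: the anomaly -1 that it inherits from -:bc: cancels against -2 h_(1) J = 1. *)
- by rewrite /= (h_J 1) /=; lmod.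
- rewrite (_ : j.+3%:Z - 1 = j.+2); last by lia.
  by rewrite h_J /= ?nth_nil; lmod.
Qed.

Let t_h : OPE t h [:: deriv h; h; (1 / 2) *: vac] := t_cur (1 / 2) r s.
Let h_t : OPE h t [:: 0; h; - (1 / 2) *: vac] := cur_t (1 / 2) r s.

Let T_T : OPE T T [:: deriv T; 2 *: T; 0; (BP_central_charge k / 2) *: vac].
Proof.
have cE : BP_central_charge k / 2 = 13 / 2 - 12 * (r * s).
  by rewrite r_s /BP_central_charge; field.
case=> [|j]; first exact: T_0.
rewrite T_mode (_ : j.+1%:Z - 1 = j); last by lia.
have TE (x : V) m : mode x m T = mode x m t + mode x m (deriv h) := modeDr x m _ _.
rewrite !TE !mode_derivr t_t h_t h_h t_h (_ : j.+1%:Z - 1 = j); last by lia.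
rewrite t_h; case: j => [|[|[|j]]].
- by rewrite /= deriv0 /T; lmod.
- by rewrite /= !derivZ !deriv_vac (h_h 0) /=; lmod.
- by rewrite /= deriv0 (h_h 1) cE /=; lmod.
- rewrite (_ : j.+3%:Z - 1 = j.+2); last by lia.
  by rewrite h_h /= ?nth_nil deriv0; lmod.
Qed.

Let cur_b p q p' : OPE (cur p q p') b [:: - p *: b].
Proof.
move=> j; rewrite !modeE n_b (OPE_commuting (com_sym bu)) (OPE_commuting (com_sym bw)).
by case: j => [|j]; rewrite /= ?nth_nil; lmod.
Qed.

Let J_b : OPE J b [:: b].
Proof. by move=> j; rewrite cur_b opprK scale1r. Qed.

(** The coefficient 1/2 of [n] in [h] raises the weight of b from 1 to 3/2. *)
Let T_b : OPE T b [:: deriv b; (3 / 2) *: b].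
Proof.
move=> j; rewrite T_mode t_b; case: j => [|[|j]].
- by rewrite /=; lmod.
- by rewrite /= (cur_b _ _ _ 0) /=; lmod.
- rewrite (_ : j.+2%:Z - 1 = j.+1); last by lia.
  by rewrite cur_b /= ?nth_nil; lmod.
Qed.

Let jj := cur 0 1 al.

Let jj_com x : commuting x u -> commuting x w -> commuting x jj.
Proof.
by move=> xu xw m l v; rewrite /jj /cur !modeDl !modeZl !modeDr !modeZr scale0r add0r xu xw; lmod.
Qed.

Let b_jj : commuting b jj := jj_com bu bw.
Let c_jj : commuting c jj := jj_com cu cw.
Let T' := mode u (- 1) w + deriv (cur 0 r s).

Let b_T' (m : nat) : mode b m%:Z T' = 0.
Proof.
have bur : commuting b (cur 0 r s).
  by move=> i l v; rewrite !modeDl !modeZl !modeDr !modeZr scale0r add0r bu bw; lmod.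
rewrite modeDr bu (OPE_commuting bw) mode_derivr (OPE_commuting bur) !nth_nil mode0r derivE.
case: m => [|m]; first by rewrite mulr0z; lmod.
by rewrite (_ : m.+1%:Z - 1 = m) ?(OPE_commuting bur) ?nth_nil; [lmod|lia].
Qed.

Let n_cur0 p q p' : mode n 0 (cur p q p') = 0.
Proof. by rewrite !modeDr !modeZr (n_n 0) (n_u 0) (n_w 0) /=; lmod. Qed.

Let n_T' : mode n 0 T' = 0.
Proof.
rewrite modeDr mode_0_mode (n_u 0) (n_w 0) mode_derivr n_cur0.
by rewrite mode0l mode0r deriv0 mulr0z; lmod.
Qed.

Hypothesis b_faithful : forall (v : V) (q : nat), mode n 0 v = q.+1%:R *: v ->
  (forall m : nat, mode b m%:Z v = 0) -> v = 0.

Lemma BP_realisation : exists J T G, BP_OPEs k (BPFields J T b G).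
Proof.
exists J, T, (Gminus_state b c k jj T').
have JE : J = - n + jj by rewrite /J /jj /cur; lmod.
have hE : deriv h = (1 / 2) *: deriv n + deriv (cur 0 r s).
  by rewrite -derivZ -derivD; congr deriv; rewrite /h /cur; lmod.
have TE : T = mode b (- 1) (deriv c) + (1 / 2) *: deriv n + T'.
  by rewrite /T hE /t /T'; lmod.
have n_t : mode n 0 t = 0.
  have nE : cur 1 0 0 = n by rewrite /cur; lmod.
  by have := cur_t 1 0 0 0; rewrite nE.
(* The charge is counted by -:bc:, so that b has charge 1, c and G^- charge -1. *)
apply: (@BP_OPEs_from_beta _ k V J T b _ (- n)) => //.
- exact: OPE_commuting.
- exact: (OPE_b_Gminus bc bb cc k b_jj c_jj b_T' JE TE).
- by rewrite modeNl n_cur0 oppr0.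
- by rewrite modeNl modeDr n_t mode_derivr n_cur0 deriv0 mulr0z; lmod.
- by rewrite modeNl (charge_Gminus bc bb cc) //; exact: n_cur0.
- move=> v q nv; apply: (b_faithful (q := q)).
  by rewrite -[LHS]opprK -modeNl nv scaleNr opprK.
Qed.

End Realisation.

(** * The realisation in the polynomial Fock space *)

Section FockRealisation.
Variable K : numFieldType.

Definition bgstate (i : bool * bool) : fock K := bgfield i (- 1) (fock1 K).

Lemma mode_bgstate i : mode (bgstate i) = bgfield i.
Proof. exact: fock_mode_gen. Qed.

Lemma bgstate_com i j m l (v : fock K) : mode (bgstate i) m (mode (bgstate j) l v) =
  mode (bgstate j) l (mode (bgstate i) m v)
  + (if (j == dualgen i) && (m + l == - 1) then gensign K i else 0) *: v.
Proof. by rewrite !mode_bgstate bgfield_com. Qed.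

Lemma bgstate_commuting i j m l (v : fock K) : j != dualgen i ->
  mode (bgstate i) m (mode (bgstate j) l v) = mode (bgstate j) l (mode (bgstate i) m v).
Proof. by move=> /negPf ji; rewrite bgstate_com ji scale0r addr0. Qed.

Local Notation beta := (bgstate (false, true)).
Local Notation gamma := (bgstate (false, false)).

Lemma beta_power n : iter n (mode beta (- 1)) vac <> 0.
Proof.
pose e n : multiindex := fun i => if i == ((false, true), 0%N) then n else 0%N.
(* The factorial comes from the normalisation by divided powers. *)
suff coef : fock_val (iter n (mode beta (- 1)) vac) (e n) = n`!%:R.
  by move=> v0; move: coef; rewrite v0 => /esym/eqP; rewrite pnatr_eq0 gtn_eqF ?fact_gt0.
rewrite mode_bgstate; elim: n => [|n IHn].
  rewrite /= /series1 (asboolT _) // => i; rewrite /e; by case: eqP.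
pose i0 : bgvar := ((false, true), 0%N).
change ((e n.+1 i0)%:R * fock_val (iter n (@bgfield K (false, true) (- 1)) vac)
  (decr i0 (e n.+1)) = n.+1`!%:R :> K).
have -> : decr i0 (e n.+1) = e n.
  by apply: funext => i; rewrite /decr /e; case: eqP => // _; rewrite subn1.
by rewrite IHn /e /i0 eqxx factS natrM.
Qed.

(** On a vector killed by all b_(j), j >= 0, the zero mode of :bc: reduces to the sum of b_(-1-j)
    c_(j), which is minus the degree in the creation variables of b. It has no positive eigenvalue,
    as each coefficient of [v] shows. *)
Lemma beta_faithful (v : fock K) (q : nat) :
  mode (mode beta (- 1) gamma) 0 v = q.+1%:R *: v ->
  (forall m : nat, mode beta m%:Z v = 0) -> v = 0.
Proof.
move=> qv bv; have [N z] := mode_evz gamma 0 v.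
move: qv; rewrite (@mode_nop _ _ _ _ _ _ N) => [|j le]; last first.
  by rewrite bv; split=> //; exact: z.
under eq_bigr => j _ do rewrite bv mode0r addr0 add0r !mode_bgstate.
move=> qv; apply: val_inj; apply: funext => e.
pose coef (x : fock K) : K := fock_val x e.
have coefD x y : coef (x + y) = coef x + coef y by [].
have coef0 : coef 0 = 0 by [].
have term (j : nat) :
    coef (bgfield (false, true) (- 1 - j%:Z) (bgfield (false, false) (0 + j%:Z) v)) =
    - ((e ((false, true), j))%:R * coef v).
  have -> : - 1 - j%:Z = Negz j by lia.
  rewrite add0r /coef /=.
  transitivity ((e ((false, true), j))%:R *
    (- 1 * fock_val v (incr ((false, true), j) (decr ((false, true), j) e)))) => [//|].
  case ej: (e _) => [|p]; first by rewrite !mul0r oppr0.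
  rewrite mulN1r mulrN; congr (- (_ * fock_val v _)); apply: funext => i.
  by rewrite /incr /decr; case: eqP => [->|_]; rewrite ?ej ?subn1 ?addn1 // subn0 addn0.
have /(congr1 coef) := qv; rewrite (big_morph coef coefD coef0).
under eq_bigr => j _ do rewrite term.
rewrite sumrN -mulr_suml -natr_sum -[RHS]/(q.+1%:R * coef v) => /eqP.
rewrite eq_sym -subr_eq0 opprK -mulrDl -natrD mulf_eq0 pnatr_eq0 addSn /= => /eqP.
exact.
Qed.

Lemma BP_fock (k om : K) : k + 3 != 0 -> om ^+ 2 = - 3 ->
  exists J T G : fock K, BP_OPEs k (BPFields J T beta G).
Proof.
move=> k3 om2.
apply: (@BP_realisation K (fock K) beta gamma (bgstate (true, true))
  (bgstate (true, false)) _ _ _ _ _ _ _ _ _ _ _ k om k3 om2 beta_faithful).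
1,2: by move=> m l v; rewrite bgstate_com /gensign /=; case: (_ == _); rewrite ?mulr1n.
all: try by move=> m l v; exact: bgstate_commuting.
move=> P P1 Plin Pg v; apply: (@bgfield_span K P) => // -[[] []] n x;
  rewrite -mode_bgstate; apply: Pg; by rewrite !inE eqxx ?orbT.
Qed.

End FockRealisation.

(** * Transfer to the universal algebra *)

Lemma morphism_power (K : numFieldType) (V W : vertexAlgType K) (f : {linear V -> W}) (a : V) n :
  va_morphism f -> f (iter n (mode a (- 1)) vac) = iter n (mode (f a) (- 1)) vac.
Proof. by move=> [f1 fm]; elim: n => //= n IHn; rewrite fm IHn. Qed.

Lemma power_opp (K : numFieldType) (V : vertexAlgType K) (a : V) n :
  iter n (mode (- a) (- 1)) vac = (- 1) ^+ n *: iter n (mode a (- 1)) vac.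
Proof.
elim: n => [|n IHn]; first by rewrite scale1r.
by rewrite !iterS IHn modeZr modeNl exprS; lmod.
Qed.

Theorem lemma8p1 (R : realType) (k : int) (hk : - 1 <= k)
    (W : vertexAlgType R[i]) (x : BPfields W)
    (hW : universal_BP (k%:~R : R[i]) x)
    (n : nat) (hn : n%:Z = k + 2) :
  singular x (iter n (Gplus x (- 1)) vac) /\
  singular x (iter n (Gminus x (- 2)) vac).
Proof.
case: hW => ope _ univ; set K := k%:~R : R[i] in ope univ.
have nK : n%:R = K + 2 by rewrite /K -[2]/(2%:Z%:~R) -intrD -hn.
have k3 : K + 3 != 0.
  by rewrite /K -[3]/(3%:Z%:~R) -intrD intr_eq0; lia.
(* The scalars are complex, which provides the square root of -3. *)
have [J [T [G opeF]]] := BP_fock k3 (sqrtCK (- 3)).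
have Gp_neq0 : iter n (mode (fGp x) (- 1)) vac <> 0.
  have [f [[fmor [_ _ fG _]] _]] := univ _ _ opeF.
  move/(congr1 f); rewrite morphism_power // fG linear0; exact: beta_power.
have Gm_neq0 : iter n (mode (fGm x) (- 1)) vac <> 0.
  have [f [[fmor [_ _ _ fG]] _]] := univ _ _ (BP_OPEs_swap opeF).
  move/(congr1 f); rewrite morphism_power // fG linear0 /= power_opp => /eqP.
  by rewrite scaler_eq0 signr_eq0 => /eqP; exact: beta_power.
clear univ; case: x ope Gp_neq0 Gm_neq0 => Jx Tx Gp Gm ope Gp_neq0 Gm_neq0.
split; first exact: (singular_power ope).
(* Singularity for the swapped fields, with G^- in the role of G^+; it differs from the claim by the
   signs of J and G^+ and the order of the two G. *)
have [v0 [q Jq] Lh ann] := singular_power (BP_OPEs_swap ope) nK Gm_neq0.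
split=> //.
- by exists (- q); rewrite scaleNr -Jq /Jm /= modeNl opprK.
- move=> i i1; have [/= Ji Li Gi Gi'] := ann i i1; split=> //.
  + by apply: oppr_inj; rewrite oppr0 -[LHS]modeNl.
  + by apply: oppr_inj; rewrite oppr0 -[LHS]modeNl.
Qed.
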